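(* Let $G$ be a locally compact group that is non-discrete but amenable-as-discrete. Then $\mathrm{LIM}_0(G)=\mathrm{LIM}(G)$.
   Context: $G$ is amenable-as-discrete if $G$ equipped with the discrete topology is an amenable group. $|E|$ denotes the left Haar measure of $E\subset G$. $\mathcal L_\infty(G)$ is the usual space with respect to Haar measure, identified with the dual of $\mathcal L_1(G)$. The set of means is $\mathcal M(G)=\{\mu\in\mathcal L_\infty^*(G): \|\mu\|=1,\ \mu\ge 0\}$. Each $f\in\mathcal L_1(G)$ is regarded as an element of $\mathcal L_\infty^*(G)$ via $\phi\mapsto\int_G f\phi$. Write $l_x\phi(y)=\phi(x^{-1}y)$. The left-invariant means are $\mathrm{LIM}(G)=\{\mu\in\mathcal M(G):\mu(\phi)=\mu(l_x\phi)\ \text{for all } x\in G,\ \phi\in\mathcal L_\infty(G)\}$. For a compact set $A\subset G$ of positive measure, $\mu_A=\chi_A/|A|$. For $K\subset G$ and $\epsilon>0$, $\mathscr C^+(K,\epsilon)$ is the set of compact $A\subset G$ with $|A|>0$ and $|xA\triangle A|/|A|<\epsilon$ for all $x\in K$. For a mean $\mu$ write $\mu(E)=\mu(\chi_E)$. For a finite measurable partition $\mathcal P$ of $G$ and $\epsilon\in(0,1)$, $\mathcal N(\mu,\mathcal P,\epsilon)=\{\nu\in\mathcal M(G): |\mu(E)-\nu(E)|<\epsilon\ \text{for all } E\in\mathcal P\}$. Then $\mathrm{LIM}_0(G)$ is the set of $\mu\in\mathrm{LIM}(G)$ such that for every finite measurable partition $\mathcal P$ of $G$, every finite $K\subset G$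 and every $\epsilon\in(0,1)$ there is $A\in\mathscr C^+(K,\epsilon)$ with $\mu_A\in\mathcal N(\mu,\mathcal P,\epsilon)$. *)

(* Defs.v *)
From HB Require Import structures.
From mathcomp Require Import all_boot all_order all_algebra.
From mathcomp Require Import all_classical all_reals all_analysis.
From mathcomp Require Import measurable_realfun.

Set Implicit Arguments.
Unset Strict Implicit.
Unset Printing Implicit Defensive.

Import Order.TTheory GRing.Theory Num.Theory.
Import numFieldNormedType.Exports.

Local Open Scope classical_set_scope.
Local Open Scope ring_scope.

HB.mixin Record isTopologicalGroup G & Group G & Topological G := {
  mulg_continuous : continuous (fun p : G * G => (p.1 * p.2)%g);
  invg_continuous : continuous (fun x : G => (x^-1)%g)
}.

(* The distinguished point is only there because measurable types are pointed;
   it plays no role. *)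
#[short(type="topologicalGroupType")]
HB.structure Definition TopologicalGroup :=
  {G of Group G & PointedTopological G & isTopologicalGroup G}.

Definition discrete_group (G : Type) : Type := G.

Section discrete_group.
Variable G : topologicalGroupType.

HB.instance Definition _ := Pointed.copy (discrete_group G) G.
HB.instance Definition _ := Group.copy (discrete_group G) G.
HB.instance Definition _ :=
  hasNbhs.Build (discrete_group G) principal_filter.
HB.instance Definition _ := Discrete_ofNbhs.Build (discrete_group G) erefl.

Lemma discrete_group_mulg_continuous : continuous
  (fun p : discrete_group G * discrete_group G =>
     (p.1 * p.2)%g : discrete_group G).
Proof.
move=> [x y] A /nbhs_singleton Axy; exists ([set x], [set y]) => /=.
  by split; exact: discrete_set1.
by move=> [_ _] /= [-> ->].
Qed.

Lemma discrete_group_invg_continuous :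
  continuous (fun x : discrete_group G => (x^-1)%g : discrete_group G).
Proof.
move=> x A /nbhs_singleton Ax.
by apply: (@filterS _ (nbhs x) _ [set x]) (discrete_set1 x) => _ ->.
Qed.

HB.instance Definition _ := isTopologicalGroup.Build (discrete_group G)
  discrete_group_mulg_continuous discrete_group_invg_continuous.

Lemma discrete_group_open (A : set (discrete_group G)) : open A.
Proof. exact: discrete_open. Qed.

End discrete_group.

Definition borel (G : topologicalGroupType) :=
  g_sigma_algebraType (@open G).

Definition ltrans (G : groupType) (x : G) (A : set G) : set G :=
  [set (x * y)%g | y in A].

Lemma ltransE (G : groupType) (x : G) (A : set G) :
  ltrans x A = [set y | A (x^-1 * y)%g].
Proof.
apply/seteqP; split=> [_ [y Ay <-]|y Ay] /=; first by rewrite mulKg.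
by exists (x^-1 * y)%g; rewrite ?mulVKg.
Qed.

Lemma measurable_mulg (G : topologicalGroupType) (x : G) :
  measurable_fun [set: borel G] (fun y : borel G => (x * y)%g : borel G).
Proof.
apply: (@measurability _ _ (borel G) (borel G) setT _ (@open G)) => //.
move=> _ [U oU <-].
rewrite setTI; apply: sub_sigma_algebra.
apply: (@open_comp G G (fun y => (x * y)%g)) => // y _.
apply: (@continuous_comp G (G * G)%type G (fun y => (x, y))
  (fun p => (p.1 * p.2)%g)); last exact: mulg_continuous.
by apply: cvg_pair; [exact: cvg_cst|exact: cvg_id].
Qed.

Lemma measurable_ltrans (G : topologicalGroupType) (x : G) (E : set (borel G)) :
  measurable E -> measurable (ltrans x E : set (borel G)).
Proof.
by move=> mE; rewrite ltransE -[X in measurable X]setTI; exact: measurable_mulg.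
Qed.

(* Radon measures in the convention where inner regularity is only required on
   open sets (and then holds on Borel sets of finite measure). *)
Record left_haar_measure (R : realType) (G : topologicalGroupType) := LeftHaar {
  haar :> {measure set (borel G) -> \bar R};
  haar_compact : forall K : set G, compact K -> (haar K < +oo)%E;
  haar_outer_regular : forall E : set (borel G), measurable E ->
    haar E = ereal_inf [set haar U | U in [set U : set G | open U /\ E `<=` U]];
  haar_inner_regular : forall U : set G, open U ->
    haar U =
      ereal_sup [set haar K | K in [set K : set G | compact K /\ K `<=` U]];
  haar_left_invariant : forall (x : G) (E : set (borel G)), measurable E ->
    haar (ltrans x E) = haar E;
  haar_neq0 : haar setT != 0%E
}.

Section means.
Variables (R : realType) (G : topologicalGroupType).
Variable mu : left_haar_measure R G.

(* As [mu] need not be sigma-finite, [L^oo] is only the dual of [L^1] if it is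
   made of the locally measurable functions, up to locally null sets, where
   "locally" means "on every Borel set of finite measure". *)
Definition locally_borel (E : set G) : Prop :=
  forall F : set (borel G), measurable F -> (mu F < +oo)%E ->
    measurable (F `&` E : set (borel G)).

Definition locally_null (E : set G) : Prop :=
  forall F : set (borel G), measurable F -> (mu F < +oo)%E ->
    mu.-negligible (F `&` E : set (borel G)).

Definition locally_measurable (phi : G -> R) : Prop :=
  forall F : set (borel G), measurable F -> (mu F < +oo)%E ->
    measurable_fun F (phi : borel G -> R).

Definition Linfty_norm (phi : G -> R) : \bar R :=
  ereal_inf [set c%:E |
    c in [set c : R | 0 <= c /\ locally_null [set x | c < `|phi x|]]].

Definition Linfty_pred : {pred G -> R} :=
  mem [set phi | locally_measurable phi /\ (Linfty_norm phi < +oo)%E].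

(* Representatives: functions that are equal locally almost everywhere are not
   identified. As [Linfty_norm] vanishes on locally null functions, functionals
   that are bounded for it are exactly those of the dual of the quotient (see
   [mean_eq_locally]). *)
Record Linfty := MkLinfty {
  Linfty_fun :> G -> R;
  Linfty_funP : Linfty_fun \in Linfty_pred
}.

HB.instance Definition _ := [isSub for Linfty_fun].
HB.instance Definition _ := [Choice of Linfty by <:].

Lemma locally_nullS (A B : set G) :
  A `<=` B -> locally_null B -> locally_null A.
Proof.
move=> AB nB F mF Ffin; apply: negligibleS (nB F mF Ffin) => x [Fx Ax].
by split=> //; exact: AB.
Qed.

Lemma locally_nullU (A B : set G) :
  locally_null A -> locally_null B -> locally_null (A `|` B).
Proof.
move=> nA nB F mF Ff; rewrite setIUr.
by apply: negligibleU; [exact: nA|exact: nB].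
Qed.

Lemma Linfty_norm_ltyP (phi : G -> R) : (Linfty_norm phi < +oo)%E <->
  exists2 c : R, 0 <= c & locally_null [set x | c < `|phi x|].
Proof.
split=> [/ereal_inf_lt[_ [c [c0 nc] <-] _]|[c c0 nc]]; first by exists c.
by rewrite (@le_lt_trans _ _ c%:E) ?ltry//; apply: ereal_inf_lbound; exists c.
Qed.

Lemma Linfty_submod_closed : submod_closed Linfty_pred.
Proof.
split=> [|a f g]; rewrite !inE /=.
  split=> [F mF _|]; first exact: measurable_cst.
  apply/Linfty_norm_ltyP; exists 0 => // F mF _.
  rewrite (_ : _ `&` _ = set0); first exact: negligible_set0.
  by rewrite -subset0 => x [_ /=]; rewrite normr0 ltxx.
move=> [mf /Linfty_norm_ltyP[c c0 nf]] [mg /Linfty_norm_ltyP[d d0 ng]]; split.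
  move=> F mF Ff; apply: measurable_funD; last exact: mg.
  by apply: measurable_funM; [exact: measurable_cst|exact: mf].
apply/Linfty_norm_ltyP; exists (`|a| * c + d).
  by rewrite addr_ge0 // mulr_ge0.
apply: locally_nullS (locally_nullU nf ng) => x /= lx.
have [lf|] := ltP c `|f x|; first by left.
move=> fc; right; rewrite ltNge; apply: contraL lx => gd.
rewrite -leNgt (le_trans (ler_normD _ _)) // lerD // normrM.
by rewrite ler_wpM2l.
Qed.

HB.instance Definition _ :=
  GRing.isSubmodClosed.Build R (G -> R) Linfty_pred Linfty_submod_closed.
HB.instance Definition _ := [SubChoice_isSubLmodule of Linfty by <:].

Definition translate (x : G) (phi : G -> R) : G -> R :=
  fun y => phi (x^-1 * y)%g.

Lemma translate_Linfty (x : G) (phi : Linfty) :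
  translate x phi \in Linfty_pred.
Proof.
case: phi => phi /=; rewrite !inE => -[mphi /Linfty_norm_ltyP[c c0 nphi]].
have back (F : set (borel G)) : measurable F -> (mu F < +oo)%E ->
    measurable (ltrans x^-1 F : set (borel G)) /\ (mu (ltrans x^-1 F) < +oo)%E.
  by move=> mF Ff; rewrite haar_left_invariant //; split=> //;
    exact: measurable_ltrans.
have shift (F A : set G) :
    F `&` [set y | A (x^-1 * y)%g] = ltrans x (ltrans x^-1 F `&` A).
  apply/seteqP; split=> y; rewrite !ltransE /= invgK mulVKg //.
split=> [F mF Ff|].
  have [mF' Ff'] := back F mF Ff.
  move=> _ Y mY.
  rewrite (_ : _ `&` _ = ltrans x (ltrans x^-1 F `&` phi @^-1` Y)).
    by apply: measurable_ltrans; exact: mphi.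
  exact: (shift F (phi @^-1` Y)).
apply/Linfty_norm_ltyP; exists c => // F mF Ff.
have [mF' Ff'] := back F mF Ff.
have [N [mN N0 sN]] := nphi _ mF' Ff'.
exists (ltrans x N); split.
- exact: measurable_ltrans.
- by rewrite haar_left_invariant.
- by rewrite (shift F [set y | c < `|phi y|]); exact: image_subset.
Qed.

Definition left_translate (x : G) (phi : Linfty) : Linfty :=
  MkLinfty (translate_Linfty x phi).

Lemma indic_Linfty (E : set G) : locally_borel E ->
  (\1_E : G -> R) \in Linfty_pred.
Proof.
move=> mE; rewrite inE; split=> [F mF Ff|].
  apply: (@eq_measurable_fun _ _ (borel G) R F (\1_(F `&` E))).
    by move=> y /set_mem Fy; rewrite !indicE in_setI (mem_set Fy).
  by apply: measurable_indic; exact: mE.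
apply/Linfty_norm_ltyP; exists 1 => // F mF _.
rewrite (_ : _ `&` _ = set0); first exact: negligible_set0.
rewrite -subset0 => x [_ /=]; rewrite indicE.
by case: (_ \in _); rewrite ?normr1 ?normr0 ?ltxx // ltNge ler01.
Qed.

Definition Linfty_indic (E : set G) (mE : locally_borel E) : Linfty :=
  MkLinfty (indic_Linfty mE).

Definition dual_norm (m : Linfty -> R) : \bar R :=
  ereal_sup [set `|m phi|%:E |
    phi in [set phi : Linfty | (Linfty_norm phi <= 1)%E]].

Definition mean : set (Linfty -> R) :=
  [set m | [/\ scalar m, dual_norm m = 1%E &
    forall phi : Linfty, locally_null [set x | phi x < 0] -> 0 <= m phi]].

Lemma mean_eq_locally (m : Linfty -> R) (phi psi : Linfty) : mean m ->
  locally_null [set x | phi x != psi x] -> m phi = m psi.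
Proof.
move=> [mlin m1 _] phipsi; apply/eqP; rewrite -subr_eq0 -normr_eq0.
have mZD a f g : m (a *: f + g) = a * m f + m g by exact: mlin.
have m0 : m 0 = 0 by have := mZD (-1) 0 0; rewrite scaler0 addr0 mulN1r addNr.
have mZ a f : m (a *: f) = a * m f.
  by rewrite -[a *: f]addr0 mZD m0 addr0.
have mB : m (phi - psi) = m phi - m psi.
  by rewrite addrC -scaleN1r mZD mulN1r addrC.
have bound (t : R) : `|t * (m phi - m psi)| <= 1.
  rewrite -mB -mZ -lee_fin -m1; apply: ereal_sup_ubound.
  exists (t *: (phi - psi)) => //=.
  apply: (@le_trans _ _ 0%E); last by rewrite lee01.
  apply: ereal_inf_lbound; exists 0 => //; split=> //.
  apply: locally_nullS phipsi => x.
  change (0 < `|t * (phi x - psi x)| -> phi x != psi x).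
  by apply: contraTneq => ->; rewrite subrr mulr0 normr0 ltxx.
apply/negPn/negP => d0.
have := bound (2 / (m phi - m psi)).
rewrite normr_eq0 in d0.
by rewrite divfK // ger0_norm // leNgt ltr1n.
Qed.

Definition LIM : set (Linfty -> R) :=
  [set m | mean m /\
    forall (x : G) (phi : Linfty), m phi = m (left_translate x phi)].

Definition L1_functional (f : G -> R) : Linfty -> R :=
  fun phi => \int[mu]_x (f x * phi x).

Definition mean_on (A : set G) : Linfty -> R :=
  L1_functional (fun x => \1_A x / fine (mu A)).

Definition Cplus (K : set G) (e : R) : set (set G) :=
  [set A | [/\ compact A, (0 < mu A)%E &
    forall x, K x -> fine (mu (ltrans x A `+` A)) / fine (mu A) < e]].

Definition measurable_partition (P : set (set G)) : Prop :=
  [/\ finite_set P, partition P id [set: G] &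
      forall E, P E -> locally_borel E].

Definition mean_nbhd (m : Linfty -> R) (P : set (set G)) (e : R) :
    set (Linfty -> R) :=
  [set n | mean n /\ forall (E : set G) (mE : locally_borel E), P E ->
    `|m (Linfty_indic mE) - n (Linfty_indic mE)| < e].

Definition LIM0 : set (Linfty -> R) :=
  [set m | LIM m /\
    forall (P : set (set G)) (K : set G) (e : R),
      measurable_partition P -> finite_set K -> 0 < e < 1 ->
      exists2 A, Cplus K e A & mean_nbhd m P e (mean_on A)].

End means.

Arguments mean {R G} mu _.
Arguments LIM {R G} mu _.
Arguments LIM0 {R G} mu _.

(* Left Haar measures are unique up to scaling, so the choice of [mu] is
   immaterial. *)
Definition amenable (R : realType) (G : topologicalGroupType) : Prop :=
  exists mu : left_haar_measure R G, LIM mu !=set0.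

Definition amenable_as_discrete (R : realType) (G : topologicalGroupType) :
    Prop :=
  amenable R (discrete_group G).

(* Main.v *)
From HB Require Import structures.
Require Import Defs.
From mathcomp Require Import all_boot all_order all_algebra.
From mathcomp Require Import all_classical all_reals all_analysis.
From mathcomp Require Import measurable_realfun.
From mathcomp Require Import ring lra.

Set Implicit Arguments.
Unset Strict Implicit.
Unset Printing Implicit Defensive.

Import Order.TTheory GRing.Theory Num.Theory.
Import numFieldNormedType.Exports.

Local Open Scope classical_set_scope.
Local Open Scope ring_scope.

(** Let [m] be a left-invariant mean and [E] one of finitely many sets. The
    required set is a union [A] of translates [t B], with [t] in a finite set
    [T] and [B] compact, such that these translates are pairwise disjoint.

    Disjointness makes the two requirements on [A] independent. Since [x A] is
    the union of the [x t B], the set [A] is almost invariant under [x] as soon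
    as the finite set [T] is, whatever [B] is; and such Folner sets [T] exist
    because the group is amenable as a discrete group ([folner]). On the other
    hand, the proportion of [E] in [A] is the average over [t] in [T] of the
    proportion of [t^-1 E] in [B]. By invariance of [m] it is close to [m E]
    if, for each [t], the proportion of [t^-1 E] in [B] is close to
    [m (t^-1 E)].

    So [T] being fixed, it remains to find [B] that meets each atom of the
    finite algebra generated by the sets [t^-1 E] in a proportion close to the
    value of [m] on this atom ([thin_sample]). Atoms to which [m] gives a
    positive value are not locally null, so they contain compact sets of
    positive measure. As the group is not discrete, points are null
    ([vol_point]). Hence one can choose in each of these compact sets a point
    of its support such that all translates of these points by [T] are
    distinct, shrink the compact sets around these points until their
    translates are disjoint ([disjoint_pieces]), and cut out of the results
    compact sets whose measures are as close as desired to any prescribed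
    small multiple of the values of [m] ([intermediate_volume]).

    Folner's theorem is proved by duality. If every finite set has a large
    boundary in the Cayley graph of [K], so has every nonnegative finitely
    supported function ([l1norm_increments_ge]). The Hahn-Banach theorem then
    provides a bounded flow on the edges of this graph whose divergence is
    bounded below by a positive constant ([flow_of_expansion]). This
    contradicts the existence of an invariant mean, which vanishes on
    divergences of bounded flows. *)

(** * Linear functionals above a cone *)

Definition sublinear (R : realType) (V : lmodType R) (q : V -> R) : Prop :=
  (forall u v, q (u + v) <= q u + q v) /\
  (forall t v, 0 < t -> q (t *: v) <= t * q v).

Section sublinear.
Variables (R : realType) (V : lmodType R).
Implicit Types (q : V -> R) (t a : R).

Lemma sublinearZ q t v : sublinear q -> 0 < t -> q (t *: v) = t * q v.
Proof.
move=> [_ qZ] t0; apply/eqP; rewrite eq_le qZ //= -ler_pdivlMl //.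
by rewrite -{1}[v](scalerK (lt0r_neq0 t0)) qZ // invr_gt0.
Qed.

Lemma sublinear0 q : sublinear q -> q 0 = 0.
Proof.
move=> ql; have := sublinearZ 0 ql (ltr0n R 2).
rewrite scaler0 => q0; lra.
Qed.

Lemma sublinear_geN q v : sublinear q -> - q (- v) <= q v.
Proof.
move=> ql; have := ql.1 v (- v); rewrite subrr (sublinear0 ql) => h; lra.
Qed.

(** Infimal convolution: the infimum of [q (w + v) - a] over the cone [C] is
    again sublinear. It is bounded below because
    [q (w + v) - a >= q v - q (- w) - a >= - q (- w)]. *)
Lemma sublinear_cone_inf q (C : V -> R -> Prop) :
  sublinear q -> C 0 0 ->
  (forall u v a b, C u a -> C v b -> C (u + v) (a + b)) ->
  (forall t v a, 0 < t -> C v a -> C (t *: v) (t * a)) ->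
  (forall v a, C v a -> a <= q v) ->
  exists q' : V -> R, [/\ sublinear q', forall v, q' v <= q v &
    forall v a, C v a -> q' (- v) <= - a].
Proof.
move=> ql C0 CD CZ Cq.
pose S w := [set x | exists v a, C v a /\ x = q (w + v) - a].
have Slb w : has_lbound (S w).
  exists (- q (- w)) => _ [v [a [Cva ->]]].
  have := ql.1 (w + v) (- w); rewrite addrC addKr => h.
  have := Cq _ _ Cva; lra.
have S0 w : S w !=set0 by exists (q w), 0, 0; rewrite addr0 subr0.
have Sle w v a : C v a -> inf (S w) <= q (w + v) - a.
  by move=> Cva; apply: ge_inf => //; exists v, a.
exists (fun w => inf (S w)); split.
- split=> [u v|t v t0].
    rewrite -lerBlDr; apply: lb_le_inf => // _ [u' [a [Ca ->]]].
    rewrite lerBlDr -lerBlDl; apply: lb_le_inf => // _ [v' [b [Cb ->]]].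
    rewrite lerBlDr; apply: le_trans (Sle _ _ _ (CD _ _ _ _ Ca Cb)) _.
    have := ql.1 (u + u') (v + v'); rewrite addrACA => h; lra.
  rewrite -ler_pdivrMl //; apply: lb_le_inf => // _ [u [a [Ca ->]]].
  rewrite ler_pdivrMl //; apply: le_trans (Sle _ _ _ (CZ _ _ _ t0 Ca)) _.
  by rewrite -scalerDr sublinearZ // mulrBr.
- by move=> v; have := Sle v _ _ C0; rewrite addr0 subr0.
- by move=> v a Cva; have := Sle (- v) _ _ Cva;
    rewrite addNr (sublinear0 ql) sub0r.
Qed.

(** The Hahn-Banach theorem in the form: a minimal sublinear functional is
    linear. Applying the infimal convolution to the ray of pairs
    [(t *: v, t * q v)] yields a smaller sublinear functional whose value at
    [- v] is at most [- q v], so that a minimal [q] is odd, hence additive.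
    Zorn's lemma provides a minimal one below [p]. *)
Lemma sublinear_minorant_linear p : sublinear p ->
  exists2 L : V -> R, scalar L & forall v, L v <= p v.
Proof.
move=> pl.
pose S := {q : V -> R | sublinear q /\ forall v, q v <= p v}.
pose le (q1 q2 : S) := `[< forall v, sval q2 v <= sval q1 v >].
have [||||[q [ql qp]] qmin] := @Zorn S le.
- by move=> q; apply/asboolP.
- move=> q1 q2 q3 /asboolP h12 /asboolP h23; apply/asboolP => v.
  exact: le_trans (h23 v) (h12 v).
- move=> [q1 h1] [q2 h2] /asboolP /= h12 /asboolP /= h21.
  by apply: eq_exist; apply/funext => v; apply/eqP; rewrite eq_le h12 h21.
- move=> A Atot; have [[q0 Aq0]|A0] := pselect (A !=set0); last first.
    exists (exist _ p (conj pl (fun v => lexx (p v)))) => s As.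
    by exfalso; apply: A0; exists s.
  pose I v := [set x | exists2 q, A q & x = sval q v].
  have I0 v : I v !=set0 by exists (sval q0 v), q0.
  have Ilb v : has_lbound (I v).
    exists (- p (- v)) => _ [q Aq ->].
    apply: le_trans (sublinear_geN v (svalP q).1).
    by rewrite lerN2 (svalP q).2.
  have Ile v (r : S) : A r -> inf (I v) <= sval r v.
    by move=> Ar; apply: ge_inf => //; exists r.
  have Is : sublinear (fun v => inf (I v)) /\ forall v, inf (I v) <= p v.
    split; last first.
      by move=> v; exact: le_trans (Ile v q0 Aq0) ((svalP q0).2 v).
    split=> [u v|t v t0].
      rewrite -lerBlDr; apply: lb_le_inf => // _ [q1 A1 ->].
      rewrite lerBlDr -lerBlDl; apply: lb_le_inf => // _ [q2 A2 ->].
      rewrite lerBlDl.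
      have [/asboolP h|/asboolP h] := Atot q1 q2 A1 A2.
        apply: le_trans (Ile _ _ A2) _.
        apply: le_trans ((svalP q2).1.1 u v) _.
        by rewrite lerD2r.
      apply: le_trans (Ile _ _ A1) _.
      apply: le_trans ((svalP q1).1.1 u v) _.
      by rewrite lerD2l.
    rewrite -ler_pdivrMl //; apply: lb_le_inf => // _ [q Aq ->].
    rewrite ler_pdivrMl //; apply: le_trans (Ile _ _ Aq) _.
    exact: (svalP q).1.2.
  (* the pointwise infimum of a chain is a lower bound of it *)
  exists (exist _ (fun v => inf (I v)) Is : S) => q Aq; apply/asboolP => v /=; exact: Ile.
have qN v : q (- v) <= - q v.
  pose C w a := exists2 t, 0 <= t & w = t *: v /\ a = t * q v.
  have [||||q' [q'l q'q q'C]] := @sublinear_cone_inf q C ql.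
  - by exists 0 => //; rewrite scale0r mul0r.
  - move=> _ _ _ _ [t t0 [-> ->]] [s s0 [-> ->]].
    by exists (t + s); rewrite ?addr_ge0 // scalerDl mulrDl.
  - move=> s _ _ s0 [t t0 [-> ->]].
    by exists (s * t); rewrite ?scalerA ?mulrA ?mulr_ge0 // ltW.
  - move=> _ _ [t + [-> ->]]; rewrite le_eqVlt => /orP[/eqP<-|t0].
      by rewrite scale0r mul0r (sublinear0 ql).
    by rewrite sublinearZ.
  have q'p w : q' w <= p w by exact: le_trans (q'q w) (qp w).
  have /(congr1 sval)/= q'E :=
    qmin (exist _ q' (conj q'l q'p)) (introT (asboolP _) q'q).
  by rewrite -{1}q'E; apply: q'C; exists 1; rewrite ?scale1r ?mul1r.
have qNE v : q (- v) = - q v.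
  apply/eqP; rewrite eq_le qN /=.
  by have := sublinear_geN (- v) ql; rewrite opprK.
have qD u v : q (u + v) = q u + q v.
  apply/eqP; rewrite eq_le ql.1 /=.
  by have := ql.1 (u + v) (- v); rewrite addrK qNE lerBrDr.
have qZ t v : q (t *: v) = t * q v.
  have [t0|t0|<-] := ltgtP 0 t; first exact: sublinearZ.
    rewrite -[t]opprK scaleNr qNE mulNr sublinearZ //; lra.
  by rewrite scale0r mul0r (sublinear0 ql).
by exists q => // a u v; rewrite qD qZ.
Qed.

(** The separation statement that produces dual certificates: a family of
    inequalities [a <= q v] that is stable under conic combinations can be
    witnessed by one linear functional. *)
Lemma linear_functional_above_cone q (C : V -> R -> Prop) :
  sublinear q -> C 0 0 ->
  (forall u v a b, C u a -> C v b -> C (u + v) (a + b)) ->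
  (forall t v a, 0 < t -> C v a -> C (t *: v) (t * a)) ->
  (forall v a, C v a -> a <= q v) ->
  exists L : V -> R, [/\ scalar L, forall v, L v <= q v &
    forall v a, C v a -> a <= L v].
Proof.
move=> ql C0 CD CZ Cq.
have [q' [q'l q'q q'C]] := sublinear_cone_inf ql C0 CD CZ Cq.
have [L Llin Lq'] := sublinear_minorant_linear q'l.
exists L; split=> // [v|v a Cva]; first exact: le_trans (Lq' v) (q'q v).
have L0 : L 0 = 0 by have := Llin (-1) 0 0; rewrite scaler0 addr0 mulN1r addNr.
have -> : L v = - L (- v).
  by have := Llin (-1) v 0; rewrite L0 !addr0 scaleN1r mulN1r => ->; rewrite opprK.
by rewrite lerNr; exact: le_trans (Lq' _) (q'C _ _ Cva).
Qed.

End sublinear.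

(** * Finitely supported functions and their l1 norm *)

Section finsupp.
Variables (R : realType) (X : choiceType).

Definition support_set (f : X -> R) : set X := [set x | f x != 0].

Definition finsupp_pred : {pred X -> R} :=
  mem [set f | finite_set (support_set f)].

Record finsupp := MkFinsupp {
  finsupp_fun :> X -> R;
  finsupp_funP : finsupp_fun \in finsupp_pred
}.

HB.instance Definition _ := [isSub for finsupp_fun].
HB.instance Definition _ := [Choice of finsupp by <:].

Lemma finsupp_submod_closed : submod_closed finsupp_pred.
Proof.
split=> [|a f g]; rewrite !inE /=.
  by apply: sub_finite_set (finite_set0 X) => x; rewrite /support_set /= eqxx.
move=> ff fg; apply: (@sub_finite_set _ _ (support_set f `|` support_set g));
  last by rewrite finite_setU.
move=> x; rewrite /support_set /=.
change (a * f x + g x != 0 -> f x != 0 \/ g x != 0) => h.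
have [fx|fx] := eqVneq (f x) 0; last by left.
by right; apply: contra_neq h; rewrite fx mulr0 add0r.
Qed.

HB.instance Definition _ :=
  GRing.isSubmodClosed.Build R (X -> R) finsupp_pred finsupp_submod_closed.
HB.instance Definition _ := [SubChoice_isSubLmodule of finsupp by <:].

Lemma finsupp_eq (f g : finsupp) : f =1 g -> f = g.
Proof. by move=> fg; apply: val_inj; apply/funext. Qed.

Lemma finsuppD (f g : finsupp) x : (f + g) x = f x + g x. Proof. by []. Qed.
Lemma finsuppN (f : finsupp) x : (- f) x = - f x. Proof. by []. Qed.
Lemma finsuppZ a (f : finsupp) x : (a *: f) x = a * f x. Proof. by []. Qed.
Lemma finsupp_sum I (r : seq I) (F : I -> finsupp) x :
  (\sum_(i <- r) F i) x = \sum_(i <- r) F i x.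
Proof.
elim: r => [|i r IH]; first by rewrite !big_nil.
by rewrite !big_cons finsuppD IH.
Qed.

Lemma mem_finsupp_seq (s : seq X) :
  (fun x => (x \in s)%:R : R) \in finsupp_pred.
Proof.
rewrite inE /=; apply: sub_finite_set (finite_seq s) => x.
by rewrite /support_set /=; case: (x \in s); rewrite ?eqxx.
Qed.

Definition fsind (s : seq X) : finsupp := MkFinsupp (mem_finsupp_seq s).

Lemma finsupp_finite (f : finsupp) : finite_set (support_set f).
Proof. by have := finsupp_funP f; rewrite inE. Qed.

Definition l1norm (f : finsupp) : R := \sum_(x \in support_set f) `|f x|.

Lemma l1normE (f : finsupp) (s : seq X) : uniq s ->
  (forall x, f x != 0 -> x \in s) -> l1norm f = \sum_(x <- s) `|f x|.
Proof.
move=> us fs; rewrite /l1norm; apply: fsbig_fwiden => //.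
by move=> x [_] /= /negP/negPn/eqP ->; rewrite normr0.
Qed.

Lemma finsupp_seq (f g : finsupp) : exists s : seq X,
  [/\ uniq s, forall x, f x != 0 -> x \in s & forall x, g x != 0 -> x \in s].
Proof.
exists (finmap.enum_fset (fset_set (support_set f `|` support_set g))).
have fin : finite_set (support_set f `|` support_set g).
  by rewrite finite_setU; split; exact: finsupp_finite.
by split; [exact: finmap.fset_uniq|..] => x h;
  rewrite in_fset_set // inE; [left|right].
Qed.

Lemma l1norm_ge0 f : 0 <= l1norm f.
Proof.
have [s [us fs _]] := finsupp_seq f f.
by rewrite (l1normE us fs) sumr_ge0.
Qed.

Lemma finsuppD_seq (f g : finsupp) (s : seq X) :
  (forall x, f x != 0 -> x \in s) -> (forall x, g x != 0 -> x \in s) ->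
  forall x, (f + g) x != 0 -> x \in s.
Proof.
move=> fs gs x; rewrite finsuppD; have [fx|/fs//] := eqVneq (f x) 0.
by rewrite fx add0r => /gs.
Qed.

Lemma l1normD_eq (f g : finsupp) :
  (forall x, `|f x + g x| = `|f x| + `|g x|) ->
  l1norm (f + g) = l1norm f + l1norm g.
Proof.
move=> fg; have [s [us fs gs]] := finsupp_seq f g.
rewrite (l1normE us fs) (l1normE us gs) (l1normE us (finsuppD_seq fs gs)).
by rewrite -big_split; apply: eq_bigr => x _; rewrite finsuppD fg.
Qed.

Lemma ler_l1normD (f g : finsupp) : l1norm (f + g) <= l1norm f + l1norm g.
Proof.
have [s [us fs gs]] := finsupp_seq f g.
rewrite (l1normE us fs) (l1normE us gs) (l1normE us (finsuppD_seq fs gs)).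
by rewrite -big_split; apply: ler_sum => x _; exact: ler_normD.
Qed.

Lemma l1normZ a f : l1norm (a *: f) = `|a| * l1norm f.
Proof.
have [s [us fs _]] := finsupp_seq f f.
have afs x : (a *: f) x != 0 -> x \in s.
  by rewrite finsuppZ mulf_eq0 negb_or => /andP[_ /fs].
rewrite (l1normE us fs) (l1normE us afs) mulr_sumr.
by apply: eq_bigr => x _; rewrite finsuppZ normrM.
Qed.

Lemma sublinear_l1norm : sublinear l1norm.
Proof.
split; first exact: ler_l1normD.
by move=> t v t0; rewrite l1normZ gtr0_norm.
Qed.

Lemma l1norm_fsind s : uniq s -> l1norm (fsind s) = (size s)%:R.
Proof.
move=> us; rewrite (@l1normE _ s) //=; last first.
  by move=> x; case: (x \in s); rewrite ?eqxx.
rewrite big_seq (eq_bigr (fun=> 1)); last by move=> x ->; rewrite normr1.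
by rewrite -big_seq big_const_seq count_predT iter_addr_0.
Qed.

Lemma size_le_l1norm (f : finsupp) s : uniq s ->
  (forall x, x \in s -> `|f x| = 1) -> (size s)%:R <= l1norm f.
Proof.
move=> us f1; have [r [ur fr _]] := finsupp_seq f f.
rewrite (l1normE ur fr) (bigID (mem s)) /= ler_wpDr ?sumr_ge0 //.
rewrite -big_filter big_seq (eq_bigr (fun=> 1)); last first.
  by move=> x; rewrite mem_filter => /andP[/f1].
rewrite -big_seq big_const_seq count_predT iter_addr_0 ler_nat.
apply: uniq_leq_size => // x xs; rewrite mem_filter /= xs fr //.
by rewrite -normr_gt0 f1.
Qed.

End finsupp.

Lemma seq_argmin (R : realType) (X : eqType) (f : X -> R) (s : seq X) :
  s != [::] -> exists2 y, y \in s & forall z, z \in s -> f y <= f z.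
Proof.
elim: s => // x [|x' s] IH _.
  by exists x; rewrite ?mem_head // => z; rewrite inE => /eqP ->.
have [//|y ys yP] := IH.
have [xy|yx] := lerP (f x) (f y).
  exists x; rewrite ?mem_head // => z; rewrite inE => /orP[/eqP->//|/yP].
  exact: le_trans.
exists y; first by rewrite inE ys orbT.
by move=> z; rewrite inE => /orP[/eqP->|/yP//]; exact: ltW.
Qed.

(** * Folner sets from an invariant mean *)

Section folner.
Variables (R : realType) (G : groupType) (K : seq G).

(** [f] is seen as a function on the vertices of the Cayley graph of [K]; the
    pair [(x, z)] stands for the edge from [x^-1 * z] to [z]. *)
Definition increments_fun (f : G -> R) : G * G -> R :=
  fun e => if e.1 \in K then f (e.1^-1 * e.2)%g - f e.2 else 0.

Lemma increments_finsupp (f : finsupp R G) :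
  increments_fun f \in @finsupp_pred R (G * G)%type.
Proof.
rewrite inE /=.
pose S := [set` K] `*` support_set f.
apply: (@sub_finite_set _ _
  (S `|` (fun e : G * G => (e.1, (e.1 * e.2)%g)) @` S)); last first.
  have fS : finite_set S by apply: finite_setX => //; exact: finsupp_finite.
  by rewrite finite_setU; split=> //; exact: finite_image.
move=> [x z]; rewrite /support_set /increments_fun /=; case: ifP => [xK|_]; last first.
  by rewrite eqxx.
have [fz|fz] := eqVneq (f z) 0; last by left.
rewrite fz subr0 => fxz; right; exists (x, (x^-1 * z)%g) => //=.
by rewrite mulVKg.
Qed.

Definition increments (f : finsupp R G) : finsupp R (G * G)%type :=
  MkFinsupp (increments_finsupp f).

Lemma incrementsE f x z :
  increments f (x, z) = if x \in K then f (x^-1 * z)%g - f z else 0.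
Proof. by []. Qed.

Lemma increments_linear : linear increments.
Proof.
move=> a f g; apply: finsupp_eq => -[x z].
rewrite finsuppD finsuppZ !incrementsE; case: ifP => _.
  by rewrite !finsuppD !finsuppZ; ring.
by rewrite mulr0 addr0.
Qed.

(** An isoperimetric inequality for finite sets extends to nonnegative
    functions, by slicing [f] into multiples of indicators of its level sets:
    both sides are additive along the slicing, since the increments of a
    level set and of what lies above it have the same sign on every edge. *)
Lemma l1norm_increments_ge (e : R) :
  (forall s, uniq s -> s != [::] ->
    e * (size s)%:R <= l1norm (increments (fsind R s))) ->
  forall f : finsupp R G, (forall y, 0 <= f y) ->
    e * l1norm f <= l1norm (increments f).
Proof.
move=> He f f0; have [s [us fs _]] := finsupp_seq f f.
have [n sn] : exists n, size s = n by exists (size s).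
elim: n s f sn us f0 fs => [|n IH] s f sn us f0 fs.
  rewrite (l1normE us fs) (size0nil sn) big_nil mulr0.
  exact: l1norm_ge0.
have s0 : s != [::] by case: (s) sn.
have [y ys ymin] := seq_argmin f s0.
(* remove the lowest slice; [y] then leaves the support *)
pose g := f - f y *: fsind R s.
have gE z : g z = f z - f y * (z \in s)%:R by [].
have fE : f = f y *: fsind R s + g by rewrite /g addrC subrK.
clearbody g.
have g0 z : 0 <= g z.
  rewrite gE; case: (boolP (z \in s)) => zs; last by rewrite mulr0 subr0.
  by rewrite mulr1 subr_ge0 ymin.
have gs z : g z != 0 -> z \in s.
  apply: contra_neqT => zs; rewrite gE (negbTE zs) mulr0 subr0.
  by apply: contraNeq zs => /fs.
have gout z : z \notin s -> g z = 0.
  by move=> zs; apply/eqP; apply: contraNT zs => /gs.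
have gs' z : g z != 0 -> z \in rem y s.
  move=> gz; rewrite mem_rem_uniq // inE gs // andbT.
  by apply: contra_neq gz => ->; rewrite gE ys mulr1 subrr.
have /= IHg := IH (rem y s) g _ (rem_uniq _ us) g0 gs'.
rewrite size_rem // sn in IHg; move: (IHg erefl) => {}IHg.
rewrite fE l1normD_eq; last first.
  move=> z; rewrite finsuppZ [fsind _ _ _]/=.
  have yz : 0 <= f y * (z \in s)%:R by rewrite mulr_ge0 ?ler0n.
  by rewrite !ger0_norm ?addr_ge0.
rewrite increments_linear l1normD_eq; last first.
  move=> [x z]; rewrite finsuppZ !incrementsE; case: ifP => _; last first.
    by rewrite mulr0 add0r normr0 add0r.
  have := g0 (x^-1 * z)%g; have := g0 z.
  have := gout z; have := gout (x^-1 * z)%g; have fy := f0 y.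
  rewrite /=; case: (_ \in s) => h1; case: (z \in s) => h2 gz gx /=.
  - by rewrite subrr mulr0 normr0 !add0r.
  - by rewrite (h2 isT) !subr0 mulr1 !ger0_norm ?addr_ge0.
  - rewrite (h1 isT) !sub0r mulrN1 -opprD !normrN.
    by rewrite !ger0_norm ?addr_ge0.
  - by rewrite subrr mulr0 normr0 !add0r.
rewrite !l1normZ l1norm_fsind // mulrDr; apply: lerD => //.
by rewrite mulrCA ler_wpM2l // He.
Qed.

(** The dual of the isoperimetric inequality: if no finite set is almost
    invariant under [K], then there is a bounded flow on the edges of the
    Cayley graph with divergence at least [e] at every vertex. The flow is the
    restriction to basis vectors of a functional of norm at most 1 for the l1
    norm that is at least [e * l1norm f] on the increments of every [f >= 0]. *)
Lemma flow_of_expansion (e : R) : uniq K ->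
  (forall s, uniq s -> s != [::] ->
    e * (size s)%:R <= l1norm (increments (fsind R s))) ->
  exists phi : G -> G -> R, (forall x y, `|phi x y| <= 1) /\
    forall y, e <= \sum_(x <- K) (phi x (x * y)%g - phi x y).
Proof.
move=> uK He.
pose C v a := exists f : finsupp R G,
  [/\ forall y, 0 <= f y, v = increments f & a = e * l1norm f].
have incrementsD f g : increments (f + g) = increments f + increments g.
  by have := increments_linear 1 f g; rewrite !scale1r.
have increments0 : increments 0 = 0.
  by have := increments_linear (-1) 0 0; rewrite scaler0 addr0 scaleN1r addNr.
have incrementsZ a f : increments (a *: f) = a *: increments f.
  by have := increments_linear a f 0; rewrite increments0 !addr0.
have [|||| L [Llin LN LC]] :=
  @linear_functional_above_cone R _ (@l1norm R (G * G)%type) C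
    (sublinear_l1norm R _).
- by exists 0; rewrite increments0 sublinear0 ?mulr0 //; exact: sublinear_l1norm.
- move=> _ _ _ _ [f [f0 -> ->]] [g [g0 -> ->]]; exists (f + g); split=> //.
  + by move=> y; rewrite finsuppD addr_ge0.
  + rewrite l1normD_eq ?mulrDr // => y.
    by rewrite !ger0_norm ?addr_ge0.
- move=> t _ _ t0 [f [f0 -> ->]]; exists (t *: f); split=> //.
  + by move=> y; rewrite finsuppZ mulr_ge0 // ltW.
  + by rewrite l1normZ gtr0_norm // mulrCA.
- by move=> _ _ [f [f0 -> ->]]; exact: l1norm_increments_ge.
have L0 : L 0 = 0 by have := Llin (-1) 0 0; rewrite scaler0 addr0 mulN1r addNr.
have LD u v : L (u + v) = L u + L v by have := Llin 1 u v; rewrite scale1r mul1r.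
have LN1 u : L (- u) = - L u.
  by have := Llin (-1) u 0; rewrite L0 !addr0 scaleN1r mulN1r.
pose phi x y := L (fsind R [:: (x, y)]).
exists phi; split=> [x y|y].
  have N1 : l1norm (fsind R [:: (x, y)]) = 1 by rewrite l1norm_fsind.
  rewrite ler_norml; apply/andP; split; last by rewrite -[leRHS]N1 LN.
  rewrite lerNl -LN1 -N1; apply: le_trans (LN _) _.
  by rewrite -scaleN1r l1normZ normrN1 mul1r.
have <- : L (increments (fsind R [:: y])) = \sum_(x <- K) (phi x (x * y)%g - phi x y).
  have -> : increments (fsind R [:: y]) =
      \sum_(x <- K) (fsind R [:: (x, (x * y)%g)] - fsind R [:: (x, y)]).
    apply: finsupp_eq => -[x z]; rewrite finsupp_sum incrementsE.
    under eq_bigr do rewrite finsuppD finsuppN /= !inE !xpair_eqE.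
    case: ifP => xK; last first.
      rewrite big1_seq // => x' /andP[_ x'K].
      have /negbTE -> : x != x' by apply: contraFneq xK => ->.
      by rewrite subrr.
    rewrite (bigD1_seq x) //= eqxx /= big1 ?addr0; last first.
      by move=> x' /negbTE; rewrite eq_sym => ->; rewrite subrr.
    by rewrite !inE (can2_eq (mulVKg x) (mulKg x)).
  elim/big_rec2: _ => [|x a b _ <-]; first by rewrite L0.
  by rewrite LD LD LN1.
apply: LC; exists (fsind R [:: y]); split=> //.
by rewrite l1norm_fsind //= mulr1.
Qed.

End folner.

Definition bounded_fct (R : realType) (G : Type) (f : G -> R) : Prop :=
  exists c, forall y, `|f y| <= c.

(** Folner's theorem. Otherwise there is a bounded flow with divergence at
    least [e]; but a divergence is a sum of differences between bounded
    functions and their translates, on which an invariant mean vanishes. *)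
Lemma folner_of_invariant_mean (R : realType) (G : groupType)
    (m : (G -> R) -> R) :
  (forall f g, bounded_fct f -> bounded_fct g ->
    m (fun y => f y + g y) = m f + m g) ->
  (forall f (e : R), 0 < e -> bounded_fct f -> (forall y, e <= f y) -> 0 < m f) ->
  (forall f x, bounded_fct f -> m (fun y => f (x * y)%g) = m f) ->
  forall (K : seq G) (e : R), 0 < e ->
  exists T : seq G, [/\ uniq T, T != [::] & forall x, x \in K ->
    (count (fun t => (x * t)%g \notin T) T)%:R <= e * (size T)%:R].
Proof.
move=> mD mpos minv K e e0; apply: contrapT => nT.
have [|s us s0|phi [phi1 phie]] := @flow_of_expansion R G (undup K) e.
- exact: undup_uniq.
- apply: contrapT => /negP; rewrite -ltNge => /ltW h; apply: nT.
  exists s; split=> // x xK; apply: le_trans h.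
  rewrite -size_filter -(size_map (fun t => (x, (x * t)%g))).
  apply: size_le_l1norm.
    by rewrite map_inj_uniq ?filter_uniq // => t t' [/mulgI].
  move=> _ /mapP[t + ->]; rewrite mem_filter => /andP[xts ts].
  by rewrite incrementsE mem_undup xK /= mulKg ts (negbTE xts) subr0 normr1.
have bphi x : bounded_fct (phi x) by exists 1.
have bphix x : bounded_fct (fun y => phi x (x * y)%g) by exists 1.
have m0 : m (fun=> 0) = 0.
  have b0 : bounded_fct (fun _ : G => 0 : R) by exists 0 => y; rewrite normr0.
  have := mD _ _ b0 b0; under [X in m X]eq_fun do rewrite addr0.
  by move=> h; lra.
have bN f : bounded_fct f -> bounded_fct (fun y : G => - f y : R).
  by move=> [c fc]; exists c => y; rewrite normrN.
have bD f g : bounded_fct f -> bounded_fct g ->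
    bounded_fct (fun y : G => f y + g y : R).
  move=> [c fc] [d gd]; exists (c + d) => y.
  by apply: le_trans (ler_normD _ _) _; exact: lerD.
have mN f : bounded_fct f -> m (fun y => - f y) = - m f.
  move=> bf; have := mD _ _ bf (bN _ bf).
  under [X in m X]eq_fun do rewrite subrr.
  by rewrite m0 => h; lra.
have [bh mh] : bounded_fct (fun y => \sum_(x <- undup K) (phi x (x * y)%g - phi x y)) /\
    m (fun y => \sum_(x <- undup K) (phi x (x * y)%g - phi x y)) = 0.
  elim: (undup K) => [|x s [bs ms]].
    under eq_fun do rewrite big_nil.
    by split=> //; exists 0 => y; rewrite normr0.
  under eq_fun do rewrite big_cons.
  have b1 := bD _ _ (bphix x) (bN _ (bphi x)).
  split; first exact: bD.
  by rewrite mD // ms addr0 mD ?mN // ?minv ?subrr //; exact: bN.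
by have := mpos _ _ e0 bh phie; rewrite mh ltxx.
Qed.

(** * Means on L-infinity *)

Section means.
Variables (R : realType) (G : topologicalGroupType).
Variable mu : left_haar_measure R G.
Implicit Types phi psi : Linfty mu.

Lemma Linfty_eq phi psi : phi =1 psi -> phi = psi.
Proof. by move=> h; apply: val_inj; apply/funext. Qed.

Lemma LinftyD phi psi x : (phi + psi) x = phi x + psi x. Proof. by []. Qed.
Lemma LinftyN phi x : (- phi) x = - phi x. Proof. by []. Qed.
Lemma LinftyZ a phi x : (a *: phi) x = a * phi x. Proof. by []. Qed.
Lemma Linfty_sum I (r : seq I) (P : pred I) (F : I -> Linfty mu) x :
  (\sum_(i <- r | P i) F i) x = \sum_(i <- r | P i) F i x.
Proof.
elim: r => [|i r IH]; first by rewrite !big_nil.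
by rewrite !big_cons; case: ifP => // _; rewrite LinftyD IH.
Qed.

Lemma locally_null0 (A : set G) : (forall x, ~ A x) -> locally_null mu A.
Proof.
move=> A0 F mF Ff; rewrite (_ : _ `&` _ = set0); first exact: negligible_set0.
by rewrite -subset0 => x [_ /A0].
Qed.

Lemma Linfty_of_bounded (f : G -> R) :
  locally_measurable mu f -> bounded_fct f -> f \in Linfty_pred mu.
Proof.
move=> mf [c fc]; rewrite inE; split=> //; apply/Linfty_norm_ltyP.
exists c; first exact: le_trans (normr_ge0 _) (fc 1%g).
by apply: locally_null0 => x /=; rewrite ltNge fc.
Qed.

Lemma one_Linfty : (fun _ : G => 1 : R) \in Linfty_pred mu.
Proof.
apply: Linfty_of_bounded; last by exists 1 => _; rewrite normr1.
by move=> F mF _; exact: measurable_cst.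
Qed.

Definition Linfty1 : Linfty mu := MkLinfty one_Linfty.

Lemma Linfty_norm_le (phi : G -> R) c : 0 <= c ->
  locally_null mu [set x | c < `|phi x|] -> (Linfty_norm mu phi <= c%:E)%E.
Proof. by move=> c0 nc; apply: ereal_inf_lbound; exists c. Qed.

Section mean.
Variable m : Linfty mu -> R.
Hypothesis mm : mean mu m.

Lemma meanP a phi psi : m (a *: phi + psi) = a * m phi + m psi.
Proof. by case: mm => + _ _; exact. Qed.

Lemma mean0 : m 0 = 0.
Proof. by have := meanP (-1) 0 0; rewrite scaler0 addr0 mulN1r addNr. Qed.

Lemma meanD phi psi : m (phi + psi) = m phi + m psi.
Proof. by have := meanP 1 phi psi; rewrite scale1r mul1r. Qed.

Lemma meanZ a phi : m (a *: phi) = a * m phi.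
Proof. by have := meanP a phi 0; rewrite mean0 !addr0. Qed.

Lemma meanN phi : m (- phi) = - m phi.
Proof. by rewrite -scaleN1r meanZ mulN1r. Qed.

Lemma mean_sum I (r : seq I) (P : pred I) (F : I -> Linfty mu) :
  m (\sum_(i <- r | P i) F i) = \sum_(i <- r | P i) m (F i).
Proof. exact: (big_morph m meanD mean0). Qed.

Lemma ler_mean phi psi :
  locally_null mu [set x | psi x < phi x] -> m phi <= m psi.
Proof.
move=> h; rewrite -subr_ge0 -meanN -meanD.
case: mm => _ _; apply; apply: locally_nullS h => x; rewrite /mkset.
by rewrite LinftyD LinftyN subr_lt0.
Qed.

(** Since [1] dominates every [phi] of norm at most 1 up to a factor
    arbitrarily close to 1, the norm of a mean is its value at [1]. *)
Lemma mean1 : m Linfty1 = 1.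
Proof.
have m1_ge0 : 0 <= m Linfty1.
  rewrite -mean0; apply: ler_mean; apply: locally_null0 => x /=.
  by rewrite ltNge ler01.
case: (mm) => _ dm _; apply/eqP; rewrite eq_le -2!lee_fin -dm; apply/andP; split.
  rewrite -[X in (X%:E <= _)%E]ger0_norm //.
  apply: ereal_sup_ubound; exists Linfty1 => //=.
  by apply: Linfty_norm_le => //; apply: locally_null0 => x /=;
    rewrite normr1 ltxx.
apply: ge_ereal_sup => _ [phi /= phi1 <-]; rewrite lee_fin.
suff H c : 1 < c -> `|m phi| <= c * m Linfty1.
  apply/ler_addgt0Pr => e e0.
  have d0 : 0 < e / (m Linfty1 + 1) by rewrite divr_gt0 // ltr_wpDl.
  apply: le_trans (H (1 + e / (m Linfty1 + 1)) _) _; first by rewrite ltrDl.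
  rewrite mulrDl mul1r lerD2l mulrAC ler_pdivrMr; last by rewrite ltr_wpDl.
  by rewrite ler_wpM2l ?lerDl // ltW.
move=> c1.
have nc : locally_null mu [set x | c < `|phi x|].
  have : (Linfty_norm mu phi < c%:E)%E by rewrite (le_lt_trans phi1) ?lte_fin.
  move=> /ereal_inf_lt[_ [d [d0 nd] <-]]; rewrite lte_fin => dc.
  by apply: locally_nullS nd => x /=; exact: lt_trans.
rewrite ler_norml; apply/andP; split.
  rewrite lerNl -meanN -meanZ; apply: ler_mean.
  apply: locally_nullS nc => x; rewrite /mkset LinftyN LinftyZ /= mulr1 => h.
  by apply: lt_le_trans h _; rewrite -normrN ler_norm.
rewrite -meanZ; apply: ler_mean.
apply: locally_nullS nc => x; rewrite /mkset LinftyZ /= mulr1 => h.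
by apply: lt_le_trans h _; rewrite ler_norm.
Qed.

Lemma mean_indic_ge0 (E : set G) (mE : locally_borel mu E) :
  0 <= m (Linfty_indic mE).
Proof.
rewrite -mean0; apply: ler_mean; apply: locally_null0 => x /=.
by rewrite indicE ltNge ler0n.
Qed.

Lemma mean_indic_null (E : set G) (mE : locally_borel mu E) :
  locally_null mu E -> m (Linfty_indic mE) = 0.
Proof.
move=> nE; rewrite -mean0; apply: mean_eq_locally => //.
apply: locally_nullS nE => x /=; rewrite indicE.
by case: (boolP (x \in E)) => [/set_mem//|_]; rewrite eqxx.
Qed.

Variables (S : finType) (sigma : G -> S).
Hypothesis msigma : forall s, locally_borel mu (sigma @^-1` [set s]).

(** A mean restricted to the functions of [sigma] is a probability on the
    finite set [S]. *)
Lemma mean_comp_finite (J : pred S) (phi : Linfty mu) :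
  (forall y, phi y = (J (sigma y))%:R) ->
  m phi = \sum_(s | J s) m (Linfty_indic (msigma s)).
Proof.
move=> phiJ; rewrite -mean_sum; congr m; apply: Linfty_eq => y.
rewrite Linfty_sum phiJ /=.
under eq_bigr do rewrite indicE.
case: (boolP (J (sigma y))) => Jy.
  rewrite (bigD1 (sigma y)) //= mem_set // big1 ?addr0 // => s /andP[_ sy].
  by rewrite memNset //= => ys; move: sy; rewrite ys eqxx.
rewrite big1 // => s Js; rewrite memNset //= => ys.
by move: Jy; rewrite ys Js.
Qed.

Lemma mean_indic_sum1 : \sum_s m (Linfty_indic (msigma s)) = 1.
Proof. by rewrite -(@mean_comp_finite predT Linfty1) ?mean1. Qed.

End mean.
End means.

(** For the discrete topology every bounded function lies in L-infinity, so a
    left-invariant mean restricts to a functional on bounded functions, to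
    which Folner's theorem applies. *)
Lemma folner (R : realType) (G : topologicalGroupType) :
  amenable_as_discrete R G ->
  forall (K : seq G) (e : R), 0 < e ->
  exists T : seq G, [/\ uniq T, T != [::] & forall x, x \in K ->
    (count (fun t => (x * t)%g \notin T) T)%:R <= e * (size T)%:R].
Proof.
move=> [mu [m [mm minv]]].
have bL (f : G -> R) : bounded_fct f -> f \in Linfty_pred mu.
  apply: (@Linfty_of_bounded R (discrete_group G)) => F mF _ _ Y mY.
  by apply: sub_sigma_algebra; exact: discrete_group_open.
(* unbounded functions get the value 0 *)
pose m' (f : G -> R) :=
  if pselect (f \in Linfty_pred mu) is left fP then m (MkLinfty fP) else 0.
have m'E f fP : m' f = m (@MkLinfty _ _ mu f fP).
  rewrite /m'; case: pselect => // fP'.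
  by congr m; apply: Linfty_eq.
apply: (@folner_of_invariant_mean R G m') => [f g bf bg|f e e0 bf fe|f x bf].
- have fP := bL _ bf; have gP := bL _ bg.
  have fgP : (fun y => f y + g y) \in Linfty_pred mu.
    exact: Linfty_funP (MkLinfty fP + MkLinfty gP).
  by rewrite !m'E -meanD //; congr m; apply: Linfty_eq.
- have fP := bL _ bf; rewrite m'E; apply: lt_le_trans e0 _.
  rewrite -[e]mulr1 -(mean1 mm) -meanZ //; apply: ler_mean => //.
  apply: locally_null0 => y; rewrite /mkset LinftyZ /= mulr1 ltNge => /negP; apply.
  exact: fe.
- have fP := bL _ bf; rewrite (m'E _ fP) (minv x^-1%g).
  have fxP : (fun y => f (x * y)%g) \in Linfty_pred mu.
    by apply: bL; case: bf => c fc; exists c => y.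
  rewrite m'E; congr m; apply: Linfty_eq => y.
  by rewrite /= /translate /= invgK.
Qed.

(** * Translations and separation of points *)

Lemma mem_bigsetU (X : Type) (I : eqType) (r : seq I) (P : pred I)
    (F : I -> set X) x :
  (\big[setU/set0]_(i <- r | P i) F i) x <-> exists i, [/\ i \in r, P i & F i x].
Proof.
elim: r => [|i r IH]; first by rewrite big_nil; split=> [[]|[i []]].
rewrite big_cons; case: ifP => Pi; split.
- move=> [Fx|/IH[j [jr Pj Fj]]]; first by exists i; rewrite mem_head.
  by exists j; rewrite inE jr orbT.
- move=> [j []]; rewrite inE => /orP[/eqP->|jr] Pj Fj; first by left.
  by right; apply/IH; exists j.
- by move=> /IH[j [jr Pj Fj]]; exists j; rewrite inE jr orbT.
- move=> [j []]; rewrite inE => /orP[/eqP->|jr] Pj Fj; first by rewrite Pi in Pj.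
  by apply/IH; exists j.
Qed.

Lemma mem_bigsetI (X : Type) (I : eqType) (r : seq I) (P : pred I)
    (F : I -> set X) x :
  (\big[setI/setT]_(i <- r | P i) F i) x <-> forall i, i \in r -> P i -> F i x.
Proof.
elim: r => [|i r IH]; first by rewrite big_nil; split.
rewrite big_cons; case: ifP => Pi; split.
- by move=> [Fx /IH h] j; rewrite inE => /orP[/eqP->//|/h].
- move=> h; split; first by apply: h; rewrite ?mem_head.
  by apply/IH => j jr; apply: h; rewrite inE jr orbT.
- move=> /IH h j; rewrite inE => /orP[/eqP->|/h//]; by rewrite Pi.
- by move=> h; apply/IH => j jr; apply: h; rewrite inE jr orbT.
Qed.

Section translations.
Variable G : topologicalGroupType.
Implicit Types (x y : G) (A B : set G).

Lemma mulgl_continuous x : continuous (fun y : G => (x * y)%g).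
Proof.
move=> y; apply: (@continuous_comp G (G * G)%type G (fun y => (x, y))
  (fun p => (p.1 * p.2)%g)); last exact: mulg_continuous.
by apply: cvg_pair; [exact: cvg_cst|exact: cvg_id].
Qed.

Lemma open_mulgl x A : open A -> open [set y | A (x * y)%g].
Proof. by move=> oA; apply: open_comp => // y _; exact: mulgl_continuous. Qed.

Lemma compact_ltrans x A : compact A -> compact (ltrans x A).
Proof.
move=> cA; apply: continuous_compact => //; apply: continuous_subspaceT.
exact: mulgl_continuous.
Qed.

Lemma mem_ltrans x A y : ltrans x A y <-> A (x^-1 * y)%g.
Proof. by rewrite ltransE. Qed.

Lemma open_of_open_point x A : open [set x] -> open A.
Proof.
move=> ox.
have -> : A = \bigcup_(a in A) [set y | [set x] (x * a^-1 * y)%g].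
  apply/seteqP; split=> [a Aa|y [a Aa /= ya]].
    by exists a => //=; rewrite mulgVK.
  suff -> : y = a by [].
  by move: ya => /(canRL (mulKg _)) ->; rewrite invgM invgK mulgVK.
by apply: bigcup_open => a _; exact: open_mulgl.
Qed.

End translations.

Lemma separate_points (X : topologicalType) (Z : seq X) : hausdorff_space X ->
  exists O : X -> set X, (forall z, open (O z) /\ O z z) /\
    forall z z', z \in Z -> z' \in Z -> z != z' -> O z `&` O z' = set0.
Proof.
move=> hX.
have /(@choice _ _ _)[W WP] : forall p : X * X, exists AB : set X * set X,
    p.1 != p.2 -> [/\ open AB.1, open AB.2, AB.1 p.1, AB.2 p.2 &
      AB.1 `&` AB.2 = set0].
  move=> [z z'] /=; have [<-|zz'] := eqVneq z z'; first by exists (set0, set0).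
  move: hX; rewrite open_hausdorff => /(_ _ _ zz')[[A B] /= [zA zB] [oA oB AB]].
  by exists (A, B) => _; split=> //; [exact: set_mem..|exact/eqP].
pose O z := \big[setI/setT]_(z' <- Z | z' != z) ((W (z, z')).1 `&` (W (z', z)).2).
have {}WP z z' : z != z' ->
    [/\ open (W (z, z')).1, open (W (z, z')).2, (W (z, z')).1 z,
      (W (z, z')).2 z' & (W (z, z')).1 `&` (W (z, z')).2 = set0].
  exact: (WP (z, z')).
exists O; split=> [z|z z' zZ z'Z zz'].
  split.
    apply: (big_ind (@open X)) => [||z' zz']; [exact: openT|exact: openI|].
    have [? _ _ _ _] := WP _ _ (contra_neq esym zz').
    by have [_ ? _ _ _] := WP _ _ zz'; exact: openI.
  apply/mem_bigsetI => z' _ zz'; split.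
    by have [_ _ ? _ _] := WP _ _ (contra_neq esym zz').
  by have [_ _ _ ? _] := WP _ _ zz'.
have z'z : z' != z by rewrite eq_sym.
rewrite -subset0 => w [/mem_bigsetI/(_ z' z'Z z'z)[h _]].
move=> /mem_bigsetI/(_ z zZ zz')[_ h'].
by have [_ _ _ _ <-] := WP _ _ zz'.
Qed.

(** * Volumes of Borel sets of finite Haar measure *)

Section haar.
Variables (R : realType) (G : topologicalGroupType).
Variable mu : left_haar_measure R G.
Implicit Types A B C E F : set G.

Definition vol A : R := fine (mu A).

Definition finite_borel A : Prop :=
  measurable (A : set (borel G)) /\ (mu A < +oo)%E.

Lemma volE A : finite_borel A -> mu A = (vol A)%:E.
Proof. by move=> [mA fA]; rewrite fineK // ge0_fin_numE. Qed.

Lemma vol_ge0 A : 0 <= vol A.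
Proof. by rewrite fine_ge0. Qed.

Lemma vol_gt0 A : finite_borel A -> (0 < vol A) = (0 < mu A)%E.
Proof. by move=> /volE ->; rewrite lte_fin. Qed.

Lemma finite_borel_sub A B : measurable (A : set (borel G)) ->
  finite_borel B -> A `<=` B -> finite_borel A.
Proof.
move=> mA [mB fB] AB; split=> //; apply: le_lt_trans fB.
by apply: le_measure => //; rewrite inE.
Qed.

Lemma finite_borelI A B : finite_borel A -> measurable (B : set (borel G)) ->
  finite_borel (A `&` B).
Proof.
move=> fA mB; apply: finite_borel_sub (fA) _; last exact: subIsetl.
by apply: measurableI => //; case: fA.
Qed.

Lemma finite_borelD A B : finite_borel A -> measurable (B : set (borel G)) ->
  finite_borel (A `\` B).
Proof.
move=> fA mB; apply: finite_borel_sub (fA) _; last exact: subDsetl.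
by apply: measurableD => //; case: fA.
Qed.

Lemma finite_borel0 : finite_borel set0.
Proof. by split; [exact: measurable0|rewrite measure0]. Qed.

Lemma finite_borelU A B :
  finite_borel A -> finite_borel B -> finite_borel (A `|` B).
Proof.
move=> [mA fA] [mB fB]; split; first exact: measurableU.
by apply: le_lt_trans (measureU2 mu mA mB) _; exact: lte_add_pinfty.
Qed.

Lemma finite_borel_bigU (I : Type) (r : seq I) (P : pred I) (F : I -> set G) :
  (forall i, P i -> finite_borel (F i)) ->
  finite_borel (\big[setU/set0]_(i <- r | P i) F i).
Proof.
by apply: (big_ind finite_borel); [exact: finite_borel0|exact: finite_borelU].
Qed.

Lemma le_vol A B : measurable (A : set (borel G)) -> finite_borel B ->
  A `<=` B -> vol A <= vol B.
Proof.
move=> mA fB AB; have fA := finite_borel_sub mA fB AB.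
rewrite -lee_fin -!volE //; apply: le_measure => //; rewrite inE //.
by case: fB.
Qed.

Lemma volU A B : finite_borel A -> finite_borel B -> A `&` B = set0 ->
  vol (A `|` B) = vol A + vol B.
Proof.
move=> fA fB AB; apply: EFin_inj; rewrite EFinD -!volE //.
  by apply: measureU => //; [case: fA|case: fB].
exact: finite_borelU.
Qed.

Lemma vol_leU A B : finite_borel A -> finite_borel B ->
  vol (A `|` B) <= vol A + vol B.
Proof.
move=> fA fB; rewrite -lee_fin EFinD -!volE //.
  by apply: measureU2 => //; [case: fA|case: fB].
exact: finite_borelU.
Qed.

Lemma vol_leD A B : finite_borel A -> finite_borel B ->
  vol A <= vol (A `\` B) + vol B.
Proof.
move=> fA fB; have fAB : finite_borel (A `\` B) by apply: finite_borelD => //; case: fB.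
apply: le_trans (vol_leU fAB fB); apply: le_vol; [by case: fA|exact: finite_borelU|].
by move=> x Ax; have [Bx|Bx] := pselect (B x); [right|left].
Qed.

Lemma vol_bigU (I : eqType) (r : seq I) (P : pred I) (F : I -> set G) :
  uniq r -> (forall i, P i -> finite_borel (F i)) ->
  (forall i j, i \in r -> j \in r -> P i -> P j -> i != j ->
    F i `&` F j = set0) ->
  vol (\big[setU/set0]_(i <- r | P i) F i) = \sum_(i <- r | P i) vol (F i).
Proof.
move=> + fF; elim: r => [|i r IH]; first by rewrite !big_nil /vol measure0.
move=> /= /andP[ir ur] dF; rewrite !big_cons.
have {}IH := IH ur; case: ifP => Pi.
  rewrite volU ?IH //.
  - by move=> j k jr kr; apply: dF; rewrite inE ?jr ?kr orbT.
  - exact: fF.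
  - exact: finite_borel_bigU.
  - rewrite -subset0 => x [Fix /mem_bigsetU[j [jr Pj Fjx]]].
    rewrite -(dF i j) ?mem_head //; first by rewrite inE jr orbT.
    by apply: contraNneq ir => ->.
by rewrite IH // => j k jr kr; apply: dF; rewrite inE ?jr ?kr orbT.
Qed.

Lemma vol_le_bigU (I : Type) (r : seq I) (P : pred I) (F : I -> set G) :
  (forall i, P i -> finite_borel (F i)) ->
  vol (\big[setU/set0]_(i <- r | P i) F i) <= \sum_(i <- r | P i) vol (F i).
Proof.
move=> fF; elim: r => [|i r IH]; first by rewrite !big_nil /vol measure0.
rewrite !big_cons; case: ifP => // Pi.
apply: le_trans (vol_leU (fF _ Pi) _) _; first exact: finite_borel_bigU.
by rewrite lerD2l.
Qed.

Lemma finite_borel_ltrans x A : finite_borel A -> finite_borel (ltrans x A).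
Proof.
move=> [mA fA]; split; first exact: measurable_ltrans.
by rewrite haar_left_invariant.
Qed.

Lemma vol_ltrans x A : finite_borel A -> vol (ltrans x A) = vol A.
Proof. by move=> [mA _]; rewrite /vol haar_left_invariant. Qed.

Lemma borel_open A : open A -> measurable (A : set (borel G)).
Proof. exact: sub_sigma_algebra. Qed.

Hypothesis hG : hausdorff_space G.

Lemma borel_compact C : compact C -> measurable (C : set (borel G)).
Proof.
move=> cC; rewrite -[C]setCK; apply: measurableC; apply: borel_open.
by apply: closed_openC; exact: compact_closed.
Qed.

Lemma finite_borel_compact C : compact C -> finite_borel C.
Proof. by move=> cC; split; [exact: borel_compact|exact: haar_compact]. Qed.

Lemma outer_open A (e : R) : finite_borel A -> 0 < e ->
  exists U, [/\ open U, A `<=` U, finite_borel U & vol U < vol A + e].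
Proof.
move=> fA e0; have [mA _] := fA.
have : (mu A < (vol A + e)%:E)%E by rewrite volE // lte_fin ltrDl.
rewrite {1}(haar_outer_regular mu mA) => /ereal_inf_lt[_ [U [oU AU] <-] Ue].
have fU : finite_borel U.
  by split; [exact: borel_open|exact: lt_trans Ue (ltry _)].
by exists U; split=> //; rewrite -lte_fin -volE.
Qed.

(** Inner regularity beyond open sets: approximate [A] by an open [U] from
    outside, take a large compact part [K] of [U], and remove from [K] an open
    set of small measure that contains [U] minus [A]. *)
Lemma inner_compact A : finite_borel A -> 0 < vol A ->
  exists C, [/\ compact C, C `<=` A & 0 < vol C].
Proof.
move=> fA A0; have e0 : 0 < vol A / 4 by rewrite divr_gt0.
have [U [oU AU fU Ue]] := outer_open fA e0.
have fUA : finite_borel (U `\` A) by apply: finite_borelD => //; case: fA.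
have UAe : vol (U `\` A) < vol A / 4.
  have : vol U = vol A + vol (U `\` A).
    rewrite -volU //; last by rewrite -subset0 => x [? []].
    by congr vol; rewrite setDUK.
  by move=> h; lra.
have [V [oV UAV fV Ve]] := outer_open fUA e0.
have : ((vol A / 2)%:E < mu U)%E.
  rewrite volE // lte_fin; have := le_vol (proj1 fA) fU AU; lra.
rewrite (haar_inner_regular mu oU) => /ereal_sup_gt[_ [K [cK KU] <-] Ke].
have fK := finite_borel_compact cK; rewrite volE // lte_fin in Ke.
exists (K `\` V); split.
- by apply: compact_closedI => //; exact: open_closedC.
- move=> x [Kx nVx]; apply: contrapT => nAx; apply: nVx; apply: UAV.
  by split=> //; exact: KU.
- have := vol_leD fK fV; lra.
Qed.

Hypothesis ndG : ~ (forall A : set G, open A).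

(** A point of positive measure would have, by outer regularity, an open
    neighbourhood too small to contain a second point, which has the same
    measure by invariance; so it would be open, and the group discrete. *)
Lemma vol_point x : vol [set x] = 0.
Proof.
have cp y : compact [set y : G] by apply: finite_compact; exact: finite_set1.
have fp y := finite_borel_compact (cp y).
apply/eqP; rewrite eq_le vol_ge0 andbT leNgt; apply/negP => x0.
have [U [oU xU fU Ux]] := outer_open (fp x) x0.
apply: ndG => A; apply: (@open_of_open_point _ x).
suff -> : [set x] = U by [].
apply/seteqP; split=> // y Uy; apply: contrapT => /eqP yx.
have : vol ([set x] `|` [set y]) <= vol U.
  apply: le_vol => //; last by move=> z [->|->] //; exact: xU.
  exact: (proj1 (finite_borelU (fp x) (fp y))).
rewrite volU //; last by rewrite -subset0 => z [/= -> xy]; rewrite xy eqxx in yx.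
have <- : ltrans (y * x^-1)%g [set x] = [set y].
  by rewrite /ltrans image_set1 mulgVK.
rewrite vol_ltrans //; lra.
Qed.

Lemma vol_seq (N : seq G) : finite_borel [set` N] /\ vol [set` N] = 0.
Proof.
have fp y : finite_borel [set y : G].
  by apply: finite_borel_compact; apply: finite_compact; exact: finite_set1.
have -> : [set` N] = \big[setU/set0]_(y <- N) [set y].
  apply/seteqP; split=> y; first by move=> yN; apply/mem_bigsetU; exists y.
  by move=> /mem_bigsetU[z [zN _ /= ->]].
split; first exact: finite_borel_bigU.
apply/eqP; rewrite eq_le vol_ge0 andbT; apply: le_trans (vol_le_bigU _ _) _ => //.
by rewrite big1 // => y _; exact: vol_point.
Qed.

(** The points of [C] with a neighbourhood that meets [C] in a null set form
    a set without compact subsets of positive measure, hence a null set, and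
    finite sets are null as well. *)
Lemma support_point C (N : seq G) : compact C -> 0 < vol C ->
  exists x, [/\ C x, x \notin N &
    forall V, open V -> V x -> 0 < vol (C `&` V)].
Proof.
move=> cC C0; have fC := finite_borel_compact cC.
have [fN N0] := vol_seq N.
have fCN : finite_borel (C `\` [set` N]).
  by apply: finite_borelD => //; case: fN.
have CN0 : 0 < vol (C `\` [set` N]) by have := vol_leD fC fN; lra.
have [C' [cC' C'C C'0]] := inner_compact fCN CN0.
apply: contrapT => nx.
have /(@choice _ _ _)[V VP] : forall x, exists V, C' x ->
    [/\ open V, V x & vol (C `&` V) = 0].
  move=> x; apply: contrapT => nV; apply: nx; exists x.
  have C'x : C' x by apply: contrapT => nC; apply: nV; exists set0.
  have [Cx /negP xN] := C'C _ C'x; split=> // V oV Vx.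
  rewrite lt_neqAle vol_ge0 andbT; apply/negP => /eqP CV0.
  by apply: nV; exists V => _.
have := cC'; rewrite compact_cover => cov.
have [x C'x|x C'x|D DC' C'D] := cov G C' V.
- by have [] := VP x C'x.
- by exists x => //; have [] := VP x C'x.
have fF x : `[< C' x >] -> finite_borel (C `&` V x).
  move=> /asboolP C'x.
  by apply: finite_borelI => //; apply: borel_open; have [] := VP x C'x.
have : vol C' <= vol (\big[setU/set0]_(x <- finmap.enum_fset D | `[< C' x >])
    (C `&` V x)).
  apply: le_vol; [exact: borel_compact|exact: finite_borel_bigU|].
  move=> y C'y; have [x /= xD Vxy] := C'D y C'y.
  apply/mem_bigsetU; exists x; split=> //.
    by apply/asboolP; apply: set_mem; exact: DC'.
  by split=> //; have [] := C'C y C'y.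
apply/negP; rewrite -ltNge; apply: le_lt_trans C'0.
apply: le_trans (vol_le_bigU _ fF) _; rewrite big1 // => x /asboolP C'x.
by have [] := VP x C'x.
Qed.

(** Every point has a neighbourhood of measure at most [d]. Removing finitely
    many of these from [C], one after the other, brings the volume down to 0
    by steps of at most [d] and keeps the sets compact. *)
Lemma intermediate_volume C (a d : R) : compact C -> 0 <= a <= vol C -> 0 < d ->
  exists B, [/\ compact B, B `<=` C & `|vol B - a| <= d].
Proof.
move=> cC aC d0.
have fp y : finite_borel [set y : G].
  by apply: finite_borel_compact; apply: finite_compact; exact: finite_set1.
have /(@choice _ _ _)[U UP] : forall x, exists U,
    [/\ open U, U x, finite_borel U & vol U <= d].
  move=> x; have [U [oU xU fU Ud]] := outer_open (fp x) d0.
  exists U; split=> //; first exact: xU.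
  by move: Ud; rewrite vol_point add0r => /ltW.
have [r Cr] : exists r : seq G, C `\` \big[setU/set0]_(x <- r) U x = set0.
  have := cC; rewrite compact_cover => cov.
  have [x _|x _|D _ CD] := cov G setT U.
  - by have [] := UP x.
  - by exists x => //; have [] := UP x.
  exists (finmap.enum_fset D); rewrite -subset0 => x [Cx]; apply.
  by have [y /= yD Uy] := CD x Cx; apply/mem_bigsetU; exists y.
elim: r C cC aC Cr => [|x r IH] C cC /andP[a0 aC] Cr.
  exists C; split=> //; move: Cr aC; rewrite big_nil setD0 => ->.
  rewrite /vol measure0 /= => a0'; rewrite (_ : a = 0) ?subr0 ?normr0 ?ltW //.
  by apply/eqP; rewrite eq_le a0'.
have [oU Ux fU Ud] := UP x.
have cCU : compact (C `\` U x).
  by apply: compact_closedI => //; exact: open_closedC.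
have [aCU|CUa] := lerP a (vol (C `\` U x)).
  have [||B [cB BC Bd]] := IH _ cCU; first by rewrite a0.
    by move: Cr; rewrite big_cons setDDl.
  by exists B; split=> // y /BC[].
exists C; split=> //; rewrite ger0_norm ?subr_ge0 //.
have := vol_leD (finite_borel_compact cC) fU; lra.
Qed.

End haar.

(** * Sampling a finite distribution by a thin compact set *)

Section sampling.
Variables (R : realType) (G : topologicalGroupType).
Variable mu : left_haar_measure R G.
Hypothesis hG : hausdorff_space G.
Hypothesis ndG : ~ (forall A : set G, open A).
Local Notation vol := (vol mu).

Lemma compact_of_not_locally_null (Q : set G) :
  locally_borel mu Q -> ~ locally_null mu Q ->
  exists C, [/\ compact C, C `<=` Q & 0 < vol C].
Proof.
move=> bQ nQ; apply: contrapT => nC; apply: nQ => F mF fF.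
have fFQ : finite_borel mu (F `&` Q).
  by apply: finite_borel_sub (conj mF fF) _; [exact: bQ|exact: subIsetl].
have FQ0 : vol (F `&` Q) = 0.
  apply/eqP; rewrite eq_le vol_ge0 andbT leNgt; apply/negP => FQ0.
  have [C [cC CFQ C0]] := inner_compact hG fFQ FQ0.
  by apply: nC; exists C; split=> // x /CFQ[].
by exists (F `&` Q); split; [exact: bQ|rewrite volE // FQ0|].
Qed.

(** The points are chosen one after the other: each new one only has to avoid
    finitely many elements of the group. *)
Lemma separated_support_points (I : eqType) (l : seq I) (C : I -> set G)
    (T : seq G) :
  (forall i, i \in l -> compact (C i) /\ 0 < vol (C i)) ->
  exists x : I -> G,
    (forall i V, i \in l -> open V -> V (x i) -> 0 < vol (C i `&` V)) /\
    (forall i j t t', i \in l -> j \in l -> t \in T -> t' \in T -> i != j ->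
      (t * x i != t' * x j)%g).
Proof.
elim: l => [|i0 l IH] Cl; first by exists (fun=> 1%g).
have [|x [xV xT]] := IH; first by move=> i il; apply: Cl; rewrite inE il orbT.
have [i0l|i0l] := boolP (i0 \in l).
  exists x; split=> [i V|i j t t']; rewrite !inE => h.
    by apply: xV; case/orP: h => [/eqP->|].
  by move=> h'; apply: xT; [case/orP: h => [/eqP->|]|case/orP: h' => [/eqP->|]].
have [cC C0] := Cl i0 (mem_head _ _).
pose N := [seq (p.1^-1 * (p.2 * x j))%g | p <- [seq (t, t') | t <- T, t' <- T],
  j <- l].
have [x0 [_ x0N x0V]] := support_point hG ndG N cC C0.
have x0P t t' j : t \in T -> t' \in T -> j \in l -> (t * x0 != t' * x j)%g.
  move=> tT t'T jl; apply: contra x0N => /eqP tx0.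
  have -> : x0 = (t^-1 * (t' * x j))%g by rewrite -tx0 mulKg.
  by apply/allpairsP; exists ((t, t'), j); split=> //=; exact: allpairs_f.
have ji0 j : j \in l -> j == i0 = false.
  by move=> jl; apply: contraNF i0l => /eqP <-.
exists (fun i => if i == i0 then x0 else x i); split=> [i V|i j t t'].
  rewrite inE => /orP[/eqP->|il] oV; first by rewrite eqxx; exact: x0V.
  by rewrite ji0 //; exact: xV.
rewrite !inE => /orP[/eqP->|il] /orP[/eqP->|jl] tT t'T; rewrite ?eqxx //.
- by rewrite (ji0 j) // => _; exact: x0P.
- by rewrite (ji0 i) // => _; rewrite eq_sym; exact: x0P.
- by rewrite !ji0 //; exact: xT.
Qed.

(** Shrinking the [C i] around well-chosen points makes all their translates
    by [T] disjoint, while each keeps positive measure. *)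
Lemma disjoint_pieces (I : eqType) (l : seq I) (C : I -> set G) (T : seq G) :
  (forall i, i \in l -> compact (C i) /\ 0 < vol (C i)) ->
  exists D : I -> set G,
    (forall i, i \in l -> [/\ compact (D i), D i `<=` C i & 0 < vol (D i)]) /\
    (forall i j t t', i \in l -> j \in l -> t \in T -> t' \in T ->
      (i, t) != (j, t') -> ltrans t (D i) `&` ltrans t' (D j) = set0).
Proof.
move=> Cl; have [x [xV xT]] := separated_support_points T Cl.
pose Z := [seq (t * x i)%g | t <- T, i <- l].
have [U [oO OZ]] := separate_points Z hG.
pose V i := \big[setI/setT]_(t <- T) [set y | U (t * x i)%g (t * y)%g].
have oV i : open (V i).
  apply: (big_ind (@open G)) => [||t _]; [exact: openT|exact: openI|].
  by apply: open_mulgl; exact: (oO _).1.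
have Vx i : V i (x i) by apply/mem_bigsetI => t _ _; exact: (oO _).2.
have /(@choice _ _ _)[D DP] : forall i, exists D, i \in l ->
    [/\ compact D, D `<=` C i `&` V i & 0 < vol D].
  move=> i; have [il|il] := boolP (i \in l); last by exists set0.
  have [cC _] := Cl i il.
  have [||D DP] := @inner_compact _ _ mu hG (C i `&` V i).
  - by apply: finite_borelI; [exact: finite_borel_compact|exact: borel_open].
  - exact: xV.
  - by exists D.
exists D; split=> [i il|i j t t' il jl tT t'T ne].
  by have [? DCV ?] := DP i il; split=> // y /DCV[].
have DsubO k s y : k \in l -> s \in T -> ltrans s (D k) y -> U (s * x k)%g y.
  move=> kl sT /mem_ltrans Dy; have [_ DCV _] := DP k kl.
  have [_ /mem_bigsetI/(_ s sT isT)] := DCV _ Dy.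
  by rewrite /mkset mulVKg.
rewrite -subset0 => y [/(DsubO _ _ _ il tT) Oy /(DsubO _ _ _ jl t'T) U'y].
rewrite -(OZ (t * x i)%g (t' * x j)%g) //; [exact: allpairs_f..|].
have [ij|ij] := eqVneq i j; last exact: xT.
move: ne; rewrite ij xpair_eqE eqxx /=; apply: contra => /eqP/mulIg ->.
exact: eqxx.
Qed.

Variables (S : finType) (sigma : G -> S) (p : S -> R).

(** A probability [p] on the values of [sigma] that charges no locally null
    fibre is realized, up to [d], as the distribution of [sigma] on a compact
    set [B] whose translates by [T] are disjoint: [B] is the union of pieces of
    the fibres, with volumes proportional to [p]. *)
Lemma thin_sample (T : seq G) (d : R) :
  (forall s, locally_borel mu (sigma @^-1` [set s])) ->
  (forall s, 0 <= p s) -> \sum_s p s = 1 ->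
  (forall s, 0 < p s -> ~ locally_null mu (sigma @^-1` [set s])) ->
  0 < d ->
  exists B, [/\ compact B, 0 < vol B,
    forall t t', t \in T -> t' \in T -> t != t' ->
      ltrans t B `&` ltrans t' B = set0 &
    forall s, measurable (B `&` sigma @^-1` [set s] : set (borel G)) /\
      `|vol (B `&` sigma @^-1` [set s]) - p s * vol B| <= d * vol B].
Proof.
move=> bQ p0 p1 nQ d0.
pose l := [seq s <- enum S | 0 < p s].
have lP s : (s \in l) = (0 < p s) by rewrite mem_filter mem_enum andbT.
have pl s : s \notin l -> p s = 0.
  by rewrite lP lt_neqAle p0 andbT negbK eq_sym => /eqP.
have ul : uniq l by rewrite filter_uniq ?enum_uniq.
have l0 : l != [::].
  apply: contraPneq p1 => l0; rewrite big1 => [/esym/eqP|s _].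
    by rewrite oner_eq0.
  by apply: pl; rewrite l0.
have suml (F : S -> R) : (forall s, s \notin l -> F s = 0) ->
    \sum_s F s = \sum_(s <- l) F s.
  move=> F0; rewrite (bigID (mem l)) /= [X in _ + X]big1 // addr0.
  by rewrite -big_filter; apply: perm_big; apply: uniq_perm => //;
    [rewrite filter_uniq ?index_enum_uniq|
     move=> s; rewrite mem_filter mem_index_enum andbT].
have /(@choice _ _ _)[C CP] : forall s, exists C, s \in l ->
    [/\ compact C, C `<=` sigma @^-1` [set s] & 0 < vol C].
  move=> s; have [sl|sl] := boolP (s \in l); last by exists set0.
  have [|C ?] := compact_of_not_locally_null (bQ s); last by exists C.
  by apply: nQ; rewrite -lP.
have [|D [DP DT]] := @disjoint_pieces _ l C T.
  by move=> s /CP[].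
have [s0 s0l s0P] := seq_argmin (fun s => vol (D s)) l0.
(* a scale at which every piece [D s] is large enough *)
pose c := vol (D s0).
have c0 : 0 < c by have [_ _] := DP _ s0l.
pose n : R := (size l)%:R.
have n0 : 0 <= n by rewrite ler0n.
(* with pieces of volume [p s * c] up to [e * c], the volume of their union
   is [c] up to [n * e * c]; this [e] makes the total error at most [d] times
   the volume of the union, see [ec] and [Alow] *)
pose e := d / (1 + d) / (n + 1).
have d1 : 0 < 1 + d by rewrite addr_gt0.
have n1 : 0 < n + 1 by rewrite ltr_wpDl.
have e0 : 0 < e by rewrite !divr_gt0.
have /(@choice _ _ _)[B BP] : forall s, exists B, s \in l ->
    [/\ compact B, B `<=` D s & `|vol B - p s * c| <= e * c].
  move=> s; have [sl|sl] := boolP (s \in l); last by exists set0.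
  have [cD _ _] := DP s sl.
  have [||B ?] := @intermediate_volume _ _ mu hG ndG (D s) (p s * c) (e * c) cD;
    last by exists B.
    rewrite mulr_ge0 ?(ltW c0) //=; apply: le_trans (s0P s sl).
    rewrite ler_piMl ?(ltW c0) // -p1 (bigD1 s) //= lerDl.
    by apply: sumr_ge0.
  by rewrite mulr_gt0.
pose A := \big[setU/set0]_(s <- l) B s.
have BD s : s \in l -> B s `<=` D s by move=> /BP[].
have Bsig s y : s \in l -> B s y -> sigma y = s.
  by move=> sl /(BD s sl) Dy; have [_ DC _] := DP s sl;
    have [_ CQ _] := CP s sl; exact: CQ (DC _ Dy).
have fB s : s \in l -> finite_borel mu (B s).
  by move=> /BP[cB _ _]; exact: finite_borel_compact.
have cA : compact A.
  rewrite /A big_seq; apply: bigsetU_compact => s sl.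
  by have [] := BP s sl.
have Asig s : A `&` sigma @^-1` [set s] = if s \in l then B s else set0.
  apply/seteqP; split=> y.
    move=> [/mem_bigsetU[s' [s'l _ By]] /= sy].
    by rewrite -sy (Bsig s') // s'l.
  case: ifP => // sl By; split; last exact: Bsig.
  by apply/mem_bigsetU; exists s.
have volA : vol A = \sum_(s <- l) vol (B s).
  rewrite /A big_seq vol_bigU //; first by rewrite -big_seq.
  move=> s s' sl s'l _ _ ss'; rewrite -subset0 => y [Bs Bs'].
  by move: ss'; rewrite -(Bsig s y) // -(Bsig s' y) // eqxx.
have pc : \sum_(s <- l) p s * c = c.
  by rewrite -mulr_suml -suml // p1 mul1r.
have Ac : `|vol A - c| <= n * (e * c).
  rewrite volA -{1}pc -sumrB; apply: le_trans (ler_norm_sum _ _ _) _.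
  rewrite big_seq; apply: le_trans (_ : _ <= \sum_(s <- l | s \in l) e * c) _.
    by apply: ler_sum => s /BP[].
  by rewrite -big_seq big_const_seq count_predT iter_addr_0 /n mulr_natl.
have ec : (n + 1) * (e * c) = d * (c / (1 + d)).
  by rewrite /e; field; rewrite !lt0r_neq0.
have Alow : c / (1 + d) <= vol A.
  have : c / (1 + d) + d * (c / (1 + d)) = c by field; rewrite lt0r_neq0.
  have ec0 : 0 < e * c by rewrite mulr_gt0.
  by move: Ac; rewrite ler_norml => /andP[Ac _]; lra.
have A0 : 0 < vol A by apply: lt_le_trans Alow; rewrite divr_gt0.
exists A; split=> //.
  move=> t t' tT t'T tt'; rewrite -subset0 => y [].
  move=> /mem_ltrans/mem_bigsetU[s [sl _ Bs]].
  move=> /mem_ltrans/mem_bigsetU[s' [s'l _ Bs']].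
  rewrite -(DT s s' t t') //; last by rewrite xpair_eqE negb_and tt' orbT.
  by split; apply/mem_ltrans; exact: BD.
move=> s; rewrite Asig; case: ifPn => sl; last first.
  split; first exact: measurable0.
  by rewrite pl // mul0r subr0 /vol measure0 normr0 mulr_ge0 // ltW.
split; first by case: (fB s sl).
have [_ _ Bc] := BP s sl.
have ps1 : p s <= 1.
  by rewrite -p1 (bigD1 s) //= lerDl; apply: sumr_ge0.
have -> : vol (B s) - p s * vol A = (vol (B s) - p s * c) - p s * (vol A - c).
  by ring.
apply: le_trans (ler_normB _ _) _; rewrite normrM (ger0_norm (p0 s)).
apply: le_trans (_ : _ <= e * c + n * (e * c)) _.
  by apply: lerD => //; apply: le_trans Ac; rewrite ler_piMl.
rewrite (_ : _ + _ = (n + 1) * (e * c)); last by ring.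
by rewrite ec ler_wpM2l // ltW.
Qed.

End sampling.

(** * The mean of a compact set *)

Section mean_on.
Variables (R : realType) (G : topologicalGroupType).
Variable mu : left_haar_measure R G.
Variable A : set G.
Hypothesis fA : finite_borel mu A.
Hypothesis A0 : 0 < vol mu A.
Local Notation vol := (vol mu).
Local Notation w := (fun x : borel G => \1_A x / vol A : R).

Let mA : measurable (A : set (borel G)). Proof. by case: fA. Qed.

Let w_ge0 x : 0 <= w x.
Proof. by rewrite divr_ge0 ?vol_ge0. Qed.

Lemma measurable_weighted (phi : G -> R) : locally_measurable mu phi ->
  measurable_fun [set: borel G] (fun x : borel G => w x * phi x).
Proof.
move=> mphi.
have -> : (fun x : borel G => w x * phi x) =
    (fun x => (vol A)^-1 * ((phi : borel G -> R) \_ (A : set (borel G))) x).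
  apply/funext => x; rewrite patchE indicE.
  by case: (x \in A); rewrite ?mul1r ?mul0r ?mulr0.
apply: measurable_funM; first exact: measurable_cst.
exact: (iffLR (measurable_restrictT (phi : borel G -> R) mA) (mphi A mA (proj2 fA))).
Qed.

Lemma integral_weight_indic (c : R) (E : set G) : 0 <= c ->
  measurable (A `&` E : set (borel G)) ->
  (\int[mu]_x (c * (w x * \1_E x))%:E = (c * (vol (A `&` E) / vol A))%:E)%E.
Proof.
move=> c0 mAE.
have fAE : finite_borel mu (A `&` E).
  by apply: finite_borel_sub mAE fA _; exact: subIsetl.
under eq_integral => x _.
  have -> : c * (w x * \1_E x) = (c / vol A) * \1_(A `&` E) x.
    rewrite !indicE in_setI; case: (x \in A); case: (x \in E);
      by rewrite /= ?mulr1 ?mul1r ?mulr0 ?mul0r ?mulr0.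
  rewrite EFinM; over.
rewrite ge0_integralZl_EFin //; last 1 first.
- by rewrite divr_ge0 ?vol_ge0.
- rewrite integral_indic // setIT volE // -EFinM; congr EFin.
  by rewrite mulrAC mulrA.
- by apply/measurable_EFinP; exact: measurable_indic.
Qed.

(** This one estimate gives integrability against the density of the uniform
    distribution on [A] and the bound 1 on the norm of the functional. *)
Lemma integral_weighted_le (phi : G -> R) (c : R) : 0 <= c ->
  locally_measurable mu phi -> locally_null mu [set x | c < `|phi x|] ->
  (\int[mu]_x `|(w x * phi x)%:E| <= c%:E)%E.
Proof.
move=> c0 mphi nc.
have mAT : measurable (A `&` setT : set (borel G)) by rewrite setIT.
have <- : (\int[mu]_x (c * (w x * \1_setT x))%:E = c%:E)%E.
  by rewrite integral_weight_indic // setIT divff ?mulr1 // lt0r_neq0.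
apply: ae_ge0_le_integral => //.
- apply: measurableT_comp => //; apply/measurable_EFinP.
  exact: measurable_weighted.
- by move=> x _; rewrite lee_fin mulr_ge0 // mulr_ge0.
- apply/measurable_EFinP; apply: measurable_funM; first exact: measurable_cst.
  apply: measurable_weighted => F mF _; exact: measurable_indic.
- apply: negligibleS (nc A mA (proj2 fA)) => x /= h.
  have : ~ `|w x * phi x| <= c * (w x * \1_setT x).
    by move=> h'; apply: h => _; rewrite lee_fin.
  rewrite indicT mulr1 normrM (ger0_norm (w_ge0 x)) mulrC indicE.
  case: (boolP (x \in A)) => [/set_mem Ax|_]; last first.
    by rewrite mul0r !mulr0 lexx.
  move=> /negP; rewrite -ltNge ltr_pM2r ?divr_gt0 //.
Qed.

Lemma integrable_weighted (phi : Linfty mu) :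
  mu.-integrable setT (EFin \o (fun x : borel G => w x * phi x)).
Proof.
have := Linfty_funP phi; rewrite inE => -[mphi /Linfty_norm_ltyP[c c0 nc]].
apply/integrableP; split.
  by apply/measurable_EFinP; exact: measurable_weighted.
exact: le_lt_trans (integral_weighted_le c0 mphi nc) (ltry _).
Qed.

Lemma mean_on_indic (E : set G) (mE : locally_borel mu E) :
  mean_on (mu := mu) A (Linfty_indic mE) = vol (A `&` E) / vol A.
Proof.
have mAE : measurable (A `&` E : set (borel G)) by apply: mE => //; case: fA.
have := integral_weight_indic ler01 mAE; rewrite mul1r.
under eq_integral do rewrite mul1r.
by rewrite /mean_on /L1_functional /Rintegral /= => ->.
Qed.

Lemma mean_mean_on : mean mu (mean_on (mu := mu) A).
Proof.
split.
- move=> a phi psi; rewrite /mean_on /L1_functional.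
  have iphi := integrable_weighted phi; have ipsi := integrable_weighted psi.
  rewrite -RintegralZl // -RintegralD //; last first.
    have -> : (fun x : borel G => a * (w x * phi x)) =
        (fun x : borel G => w x * (a *: phi) x).
      by apply/funext => x; rewrite LinftyZ mulrCA.
    exact: integrable_weighted.
  apply: eq_Rintegral => x _; rewrite LinftyD LinftyZ; ring.
- apply/eqP; rewrite eq_le; apply/andP; split.
    apply: ge_ereal_sup => _ [phi /= phi1 <-].
    apply/lee_addgt0Pr => e e0; rewrite -EFinD.
    have := Linfty_funP phi; rewrite inE => -[mphi _].
    have [_ [d [d0 nd] <-]] : exists2 x, [set c%:E | c in
        [set c : R | 0 <= c /\ locally_null mu [set x | c < `|phi x|]]] x &
        (x < (1 + e)%:E)%E.
      apply: ereal_inf_lt; apply: le_lt_trans phi1 _.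
      by rewrite lte_fin ltrDl.
    rewrite lte_fin => /ltW de.
    apply: le_trans (_ : (_ <= d%:E)%E) _; last by rewrite lee_fin.
    apply: le_trans (integral_weighted_le d0 mphi nd).
    rewrite -[X in (_ <= X)%E]fineK; last first.
      have /integrableP[_ fin] := integrable_weighted phi.
      by rewrite ge0_fin_numE // integral_ge0.
    rewrite lee_fin.
    exact: (le_normr_Rintegral measurableT (integrable_weighted phi)).
  have mT : locally_borel mu setT by move=> F mF _; rewrite setIT.
  apply: ereal_sup_ubound; exists (Linfty_indic mT) => /=.
    apply: Linfty_norm_le => //; apply: locally_null0 => x /=.
    by rewrite indicT normr1 ltxx.
  by rewrite mean_on_indic setIT divff ?normr1 // lt0r_neq0.
- move=> phi phi0; rewrite /mean_on /L1_functional /Rintegral.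
  have := Linfty_funP phi; rewrite inE => -[mphi _].
  have mw := measurable_weighted mphi.
  rewrite (@ae_eq_integral _ _ _ _ _ (fun x => `|(w x * phi x)%:E|)%E) //.
  + by apply: fine_ge0; exact: integral_ge0.
  + by apply/measurable_EFinP.
  + by apply: measurableT_comp => //; apply/measurable_EFinP.
  + apply: negligibleS (phi0 A mA (proj2 fA)) => x /= h.
    have : ~ 0 <= w x * phi x.
      by move=> h'; apply: h => _; rewrite ger0_norm.
    case: (boolP (x \in A)) => [/set_mem Ax|xA].
      by move=> nh; split=> //; rewrite ltNge; apply: contra_notN nh => ?;
        rewrite mulr_ge0.
    by rewrite indicE (negbTE xA) !mul0r lexx.
Qed.

End mean_on.

(** * Folner sets of prescribed distribution *)

Section locally_borel.
Variables (R : realType) (G : topologicalGroupType).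
Variable mu : left_haar_measure R G.
Implicit Types E F : set G.

Lemma locally_borelI E F :
  locally_borel mu E -> locally_borel mu F -> locally_borel mu (E `&` F).
Proof.
move=> bE bF H mH fH; rewrite setIIr; apply: measurableI; [exact: bE|exact: bF].
Qed.

Lemma locally_borelC E : locally_borel mu E -> locally_borel mu (~` E).
Proof.
move=> bE H mH fH.
have -> : H `&` ~` E = H `\` (H `&` E) by rewrite setDIr setDv set0U setDE.
by apply: measurableD => //; exact: bE.
Qed.

Lemma locally_borel_mulgl t E :
  locally_borel mu E -> locally_borel mu [set y | E (t * y)%g].
Proof.
move=> bE H mH fH.
have -> : H `&` [set y | E (t * y)%g] = ltrans t^-1%g (ltrans t H `&` E).
  by apply/seteqP; split=> y; rewrite !ltransE /= invgK mulKg.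
apply: measurable_ltrans; apply: bE; first exact: measurable_ltrans.
by rewrite haar_left_invariant.
Qed.

Lemma locally_borel_bigI (I : Type) (r : seq I) (F : I -> set G) :
  (forall i, locally_borel mu (F i)) ->
  locally_borel mu (\big[setI/setT]_(i <- r) F i).
Proof.
move=> bF; apply: (big_ind (locally_borel mu)) => //.
  by move=> H mH _; rewrite setIT.
by move=> E E'; exact: locally_borelI.
Qed.

End locally_borel.

Section signature.
Variables (R : realType) (G : topologicalGroupType).
Variable mu : left_haar_measure R G.
Variables (T : seq G) (Es : seq (set G)).
Hypothesis bE : forall E, E \in Es -> locally_borel mu E.

Definition signature_index := ('I_(size T) * 'I_(size Es))%type.

Definition hits (q : signature_index) : set G :=
  [set y | nth set0 Es q.2 (nth 1%g T q.1 * y)%g].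

(** [signature y] records which of the sets of [Es] contain which of the
    union_translates [t * y], for [t] in [T]: the atoms of the algebra generated by
    the sets [t^-1 E] are its fibres. *)
Definition signature (y : G) : {ffun signature_index -> bool} :=
  [ffun q => `[< hits q y >]].

Lemma locally_borel_signature s :
  locally_borel mu (signature @^-1` [set s]).
Proof.
have -> : signature @^-1` [set s] = \big[setI/setT]_(q <- enum {: signature_index})
    (if s q then hits q else ~` hits q).
  apply/seteqP; split=> y.
    move=> /= <-; apply/mem_bigsetI => q _ _; rewrite ffunE.
    by case: ifPn => /asboolP.
  move=> /mem_bigsetI h; apply/ffunP => q; rewrite ffunE.
  have := h q (mem_enum _ _) isT.
  by case: (s q) => hq; [apply/asboolP|apply/asboolPn].
apply: locally_borel_bigI => q.
have bq : locally_borel mu (hits q).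
  by apply: locally_borel_mulgl; apply: bE; exact: mem_nth.
by case: ifP => // _; exact: locally_borelC.
Qed.

End signature.

Section invariance.
Variables (R : realType) (G : topologicalGroupType).
Variable mu : left_haar_measure R G.
Hypothesis hG : hausdorff_space G.
Local Notation vol := (vol mu).

Variables (T : seq G) (B : set G).
Hypotheses (uT : uniq T) (cB : compact B).
Hypothesis dB : forall t t', t \in T -> t' \in T -> t != t' ->
  ltrans t B `&` ltrans t' B = set0.

Definition union_translates : set G := \big[setU/set0]_(t <- T) ltrans t B.

Lemma compact_union_translates : compact union_translates.
Proof. by apply: bigsetU_compact => t _; exact: compact_ltrans. Qed.

Let fB t : finite_borel mu (ltrans t B).
Proof. by apply: finite_borel_ltrans; exact: finite_borel_compact. Qed.

Lemma vol_union_translates : vol union_translates = (size T)%:R * vol B.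
Proof.
rewrite vol_bigU //; last by move=> t t' tT t'T _ _; exact: dB.
rewrite (eq_bigr (fun=> vol B)); last first.
  by move=> t _; apply: vol_ltrans; exact: finite_borel_compact.
by rewrite big_const_seq count_predT iter_addr_0 mulr_natl.
Qed.

Lemma vol_union_translatesI E : locally_borel mu E ->
  vol (union_translates `&` E) = \sum_(t <- T) vol (B `&` [set y | E (t * y)%g]).
Proof.
move=> bE.
have fBE t : finite_borel mu (B `&` [set y | E (t * y)%g]).
  have [mB fB'] := finite_borel_compact mu hG cB.
  apply: finite_borel_sub (conj mB fB') _; last exact: subIsetl.
  exact: (@locally_borel_mulgl _ _ mu t E bE B mB fB').
have -> : union_translates `&` E =
    \big[setU/set0]_(t <- T) ltrans t (B `&` [set y | E (t * y)%g]).
  apply/seteqP; split=> y.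
    move=> [/mem_bigsetU[t [tT _ By]] Ey]; apply/mem_bigsetU; exists t; split=> //.
    by move: By; rewrite !ltransE /= mulVKg.
  move=> /mem_bigsetU[t [tT _ /mem_ltrans[By]]] /=; rewrite mulVKg => Ey.
  by split=> //; apply/mem_bigsetU; exists t; rewrite ltransE /=.
rewrite vol_bigU //.
- by apply: eq_bigr => t _; exact: vol_ltrans.
- by move=> t _; exact: finite_borel_ltrans.
- move=> t t' tT t'T _ _ tt'; rewrite -subset0 -(dB tT t'T tt') => y.
  by rewrite !ltransE => -[[? _] [? _]].
Qed.

(** Translating the union by [x] moves [ltrans t B] to [ltrans (x * t) B], so
    that only the [t] which leave [T] contribute, however irregular [B] is. *)
Lemma vol_symdiff_union_translates x (e : R) :
  (count (fun t => (x * t)%g \notin T) T)%:R <= e * (size T)%:R ->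
  (count (fun t => (x^-1 * t)%g \notin T) T)%:R <= e * (size T)%:R ->
  vol (ltrans x union_translates `+` union_translates) <= 2 * e * vol union_translates.
Proof.
move=> h1 h2; have fA := finite_borel_compact mu hG compact_union_translates.
pose U1 := \big[setU/set0]_(t <- T | (x * t)%g \notin T) ltrans (x * t)%g B.
pose U2 := \big[setU/set0]_(t <- T | (x^-1 * t)%g \notin T) ltrans t B.
have f1 : finite_borel mu U1 by exact: finite_borel_bigU.
have f2 : finite_borel mu U2 by exact: finite_borel_bigU.
have count_vol (P : pred G) (F : G -> G) :
    vol (\big[setU/set0]_(t <- T | P t) ltrans (F t) B) <= (count P T)%:R * vol B.
  apply: le_trans (vol_le_bigU _ _) _ => //.
  rewrite (eq_bigr (fun=> vol B)); last first.
    by move=> t _; apply: vol_ltrans; exact: finite_borel_compact.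
  by rewrite big_const_seq iter_addr_0 mulr_natl.
have le1 : vol U1 <= e * (size T)%:R * vol B.
  by apply: le_trans (count_vol _ _) _; rewrite ler_wpM2r ?vol_ge0.
have le2 : vol U2 <= e * (size T)%:R * vol B.
  by apply: le_trans (count_vol _ _) _; rewrite ler_wpM2r ?vol_ge0.
have sub : ltrans x union_translates `+` union_translates `<=` U1 `|` U2.
  move=> y [[/mem_ltrans/mem_bigsetU[t [tT _ /mem_ltrans By]] nA]|
      [/mem_bigsetU[t [tT _ /mem_ltrans By]] nA]].
    left; apply/mem_bigsetU; exists t; split=> //; last first.
      by rewrite ltransE /= invgM -mulgA.
    apply/negP => xtT; apply: nA; apply/mem_bigsetU; exists (x * t)%g; split=> //.
    by rewrite ltransE /= invgM -mulgA.
  right; apply/mem_bigsetU; exists t; split=> //; last by rewrite ltransE /=.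
  apply/negP => xtT; apply: nA; apply/mem_ltrans; apply/mem_bigsetU.
  by exists (x^-1 * t)%g; split=> //; rewrite ltransE /= invgM invgK -mulgA mulVKg.
have fxA := finite_borel_ltrans x fA.
have fX : finite_borel mu (ltrans x union_translates `+` union_translates).
  by apply: finite_borelU; apply: finite_borelD => //; [case: fA|case: fxA].
apply: le_trans (le_vol (proj1 fX) (finite_borelU f1 f2) sub) _.
apply: le_trans (vol_leU f1 f2) _; rewrite vol_union_translates; lra.
Qed.

End invariance.

(** [T] is a Folner set of the discrete group and [B] samples the
    distribution of the signature under [m]. For each [t] in [T], the
    proportion of [E] in [ltrans t B] is that of [t^-1 E] in [B], close to
    [m (t^-1 E)], which is [m E] by invariance. *)
Lemma folner_set_approximating_LIM (R : realType) (G : topologicalGroupType)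
    (mu : left_haar_measure R G) (m : Linfty mu -> R) :
  hausdorff_space G -> ~ (forall A : set G, open A) ->
  amenable_as_discrete R G -> LIM mu m ->
  forall (Es : seq (set G)) (K : seq G) (e : R),
    (forall E, E \in Es -> locally_borel mu E) -> 0 < e ->
    exists A, [/\ compact A, 0 < vol mu A,
      forall x, x \in K -> vol mu (ltrans x A `+` A) < e * vol mu A &
      forall E (bE : locally_borel mu E), E \in Es ->
        `|m (Linfty_indic bE) - vol mu (A `&` E) / vol mu A| < e].
Proof.
move=> hG ndG amG [mm minv] Es K e bEs e0.
have [T [uT T0 KT]] := folner amG (K ++ [seq x^-1%g | x <- K]) (divr_gt0 e0 (ltr0n R 3)).
have bsig := @locally_borel_signature R G mu T Es bEs.
pose p s := m (Linfty_indic (bsig s)).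
pose N : R := #|{ffun signature_index T Es -> bool}|%:R.
have N0 : 0 <= N by rewrite ler0n.
have d0 : 0 < e / (N + 1) by rewrite divr_gt0 // ltr_wpDl.
have [|||B [cB B0 dB Bs]] :=
  @thin_sample R G mu hG ndG _ (@signature G T Es) p T _ bsig _ _ _ d0.
- by move=> s; exact: mean_indic_ge0.
- exact: mean_indic_sum1.
- by move=> s ps ns; move: ps; rewrite /p mean_indic_null // ltxx.
pose A := union_translates T B.
have fB := finite_borel_compact mu hG cB.
have vA : vol mu A = (size T)%:R * vol mu B by exact: vol_union_translates.
have k0 : 0 < (size T)%:R :> R by rewrite ltr0n lt0n size_eq0.
have A0 : 0 < vol mu A by rewrite vA mulr_gt0.
exists A; split=> //; first exact: compact_union_translates.
  move=> x xK.
  apply: le_lt_trans (@vol_symdiff_union_translates _ _ mu hG T B uT cB dB x (e / 3) _ _) _.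
  - by apply: KT; rewrite mem_cat xK.
  - by apply: KT; rewrite mem_cat map_f ?orbT.
  - by rewrite -/A ltr_pM2r //; lra.
move=> E bE EEs.
have bound t : t \in T ->
    `|m (Linfty_indic bE) * vol mu B - vol mu (B `&` [set y | E (t * y)%g])|
      <= N * (e / (N + 1) * vol mu B).
  move=> tT.
  pose a := Ordinal (introT idP (eq_trans (index_mem t T) tT) : index t T < size T)%N.
  pose i := Ordinal (introT idP (eq_trans (index_mem E Es) EEs) : index E Es < size Es)%N.
  have hitE y : hits (a, i) y <-> E (t * y)%g.
    by rewrite /hits /= !nth_index.
  have mE : m (Linfty_indic bE) =
      \sum_(s : {ffun signature_index T Es -> bool} | s (a, i)) p s.
    rewrite (minv t^-1%g).
    apply: (mean_comp_finite mm bsig (J := fun s => s (a, i))) => y.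
    rewrite /= /translate invgK indicE ffunE; congr (nat_of_bool _)%:R.
    by apply/idP/asboolP => [/set_mem/hitE|/hitE/mem_set].
  have -> : B `&` [set y | E (t * y)%g] =
      \big[setU/set0]_(s : {ffun signature_index T Es -> bool} | s (a, i))
         (B `&` signature T Es @^-1` [set s]).
    apply/seteqP; split=> y.
      move=> [By /hitE hy]; apply/mem_bigsetU; exists (signature T Es y).
      by rewrite mem_index_enum; split=> //; rewrite ffunE; apply/asboolP.
    move=> /mem_bigsetU[s [_ si [By /= ys]]]; split=> //; apply/hitE.
    by move: si; rewrite -ys ffunE => /asboolP.
  rewrite vol_bigU ?index_enum_uniq //; last first.
  - move=> s s' _ _ _ _ ss'; rewrite -subset0 => y [[_ /= ys] [_ /= ys']].
    by move: ss'; rewrite -ys -ys' eqxx.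
  - by move=> s _; apply: finite_borel_sub fB _; [case: (Bs s)|exact: subIsetl].
  rewrite mE mulr_suml -sumrB; apply: le_trans (ler_norm_sum _ _ _) _.
  apply: le_trans (_ : _ <= \sum_(s : {ffun signature_index T Es -> bool}
      | s (a, i)) e / (N + 1) * vol mu B) _.
    by apply: ler_sum => s _; rewrite distrC; case: (Bs s).
  rewrite sumr_const -mulr_natl ler_wpM2r //; last by rewrite /N ler_nat max_card.
  by rewrite mulr_ge0 ?vol_ge0 // ltW.
have -> : m (Linfty_indic bE) - vol mu (A `&` E) / vol mu A =
    (m (Linfty_indic bE) * vol mu A - vol mu (A `&` E)) / vol mu A.
  by rewrite mulrBl mulfK // lt0r_neq0.
rewrite normrM normfV (gtr0_norm A0) ltr_pdivrMr //.
apply: le_lt_trans (_ : _ <= (size T)%:R * (N * (e / (N + 1) * vol mu B))) _.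
  rewrite (vol_union_translatesI hG uT cB dB bE).
  have -> : m (Linfty_indic bE) * vol mu A =
      \sum_(t <- T) m (Linfty_indic bE) * vol mu B.
    by rewrite big_const_seq count_predT iter_addr_0 vA mulrCA mulr_natl.
  rewrite -sumrB; apply: le_trans (ler_norm_sum _ _ _) _.
  rewrite big_seq; apply: le_trans (ler_sum _ bound) _.
  by rewrite -big_seq big_const_seq count_predT iter_addr_0 mulr_natl.
have -> : (size T)%:R * (N * (e / (N + 1) * vol mu B)) =
    N / (N + 1) * e * vol mu A.
  by rewrite vA; ring.
by rewrite ltr_pM2r // gtr_pMl // ltr_pdivrMr ?ltr_wpDl // mul1r ltrDl.
Qed.

Theorem theorem7p4 (R : realType) (G : topologicalGroupType)
    (mu : left_haar_measure R G) :
  hausdorff_space G -> locally_compact [set: G] ->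
  ~ (forall A : set G, open A) ->
  amenable_as_discrete R G ->
  LIM0 mu = LIM mu.
Proof.
move=> hG _ ndG amG; apply/seteqP; split=> [m []//|m mL].
split=> // P K e [finP _ bP] finK /andP[e0 _].
pose Es : seq (set G) := finmap.enum_fset (fset_set P).
pose Ks : seq G := finmap.enum_fset (fset_set K).
have EsP E : (E \in Es) = (E \in P) by rewrite /Es in_fset_set.
have KsK x : (x \in Ks) = (x \in K) by rewrite /Ks in_fset_set.
have [|A [cA A0 AK AE]] := folner_set_approximating_LIM hG ndG amG mL Ks (Es := Es) _ e0.
  by move=> E; rewrite EsP => /set_mem /bP.
have fA := finite_borel_compact mu hG cA.
exists A.
  split=> //; first by rewrite -vol_gt0.
  by move=> x Kx; rewrite ltr_pdivrMr //; apply: AK; rewrite KsK; exact: mem_set.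
split; first exact: mean_mean_on.
move=> E bE PE; rewrite mean_on_indic //; apply: AE.
by rewrite EsP; exact: mem_set.
Qed.
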